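(* Let $\mathcal{B}\subset\mathbb{M}_r$ be a matrix ring and let $\pi:\mathbb{M}_r\to\mathbb{M}_r$ be a positive linear map with $\pi\circ\pi=\pi$ and $\pi(\mathbb{M}_r)=\mathcal{B}$ such that for every $Q\in\mathbb{M}_r$ $$\pi(Q)=\arg\min_{B\in\mathcal{B}}\ \pi\left[(Q-B)(Q-B)'\right]$$ (minimum with respect to the Loewner order). Assume that $A,A',S,R\in\mathcal{B}$. Then for all $x\in\mathbb{R}^r$, $Q\in\mathbb{S}_r^+$ and all times $0\le s\le t$, $$\phi^{\pi}_t(\pi(Q))=\phi_t(\pi(Q))\qquad\text{and}\qquad \psi^{\pi}_{s,t}(x,Q)=\psi_{s,t}(x,\pi(Q)).$$ In addition, there exists $\rho>0$ such that for any $Q\in\mathbb{S}_r^+$ and any $t\ge 0$, $$\Vert \phi^{\pi}_t(Q)-\phi_t(Q)\Vert_2\le c_Q\,e^{-\rho t}\,\Vert Q-\pi(Q)\Vert_2$$ for some finite constant $c_Q$ whose value depends only on $\Vert Q\Vert_2$ (the system matrices and $\pi$ being fixed).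
   Context: Notation: $\mathbb{M}_r$ = real $r\times r$ matrices, $\mathbb{S}_r^+\subset\mathbb{S}_r\subset \mathbb{M}_r$ = symmetric positive semi-definite (resp. symmetric) matrices, $\le$ = Loewner order, $'$ = transpose, $\Vert\cdot\Vert_2$ = spectral norm. A map $\pi$ on $\mathbb{M}_r$ is positive if $\pi(\mathbb{S}_r^+)\subseteq\mathbb{S}_r^+$. Standing setting: $A\in\mathbb{M}_r$, $C$ is a real $r'\times r$ matrix, $R\in\mathbb{S}_r^+$ and $\Sigma\in\mathbb{S}_{r'}^+$ are positive definite, $S:=C'\Sigma^{-1}C$; the pair $(A,R^{1/2})$ is controllable and $(A,C)$ is observable. The signal and observation satisfy $dX_t=AX_t\,dt+R^{1/2}dW_t$, $dY_t=CX_t\,dt+\Sigma^{1/2}dV_t$, $Y_0=0$, with $(W,V)$ a standard $(r+r')$-dimensional Brownian motion independent of the Gaussian vector $X_0$. Riccati flow: $\mathrm{Ricc}(Q)=AQ+QA'-QSQ+R$; $\phi_t(Q)$ is the solution at time $t$ of $\partial_t\phi_t(Q)=\mathrm{Ricc}(\phi_t(Q))$, $\phi_0(Q)=Q$; $\phi_{s,t}:=\phi_{t-s}$. $\pi$-Riccati flow: $\mathrm{Ricc}^{\pi}(Q)=[A-\pi(Q)S]Q+Q[A-\pi(Q)S]'+R+\pi(Q)S\pi(Q)$; $\phi^{\pi}_t(Q)$ solves $\partial_t\phi^{\pi}_t(Q)=\mathrm{Ricc}^{\pi}(\phi^{\pi}_t(Q))$, $\phi^{\pi}_0(Q)=Q$;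 $\phi^{\pi}_{s,t}:=\phi^{\pi}_{t-s}$. Filters: for $t\ge s$, $\psi_{s,t}(x,Q)$ solves $d\psi_{s,t}=A\psi_{s,t}\,dt+\phi_{s,t}(Q)C'\Sigma^{-1}(dY_t-C\psi_{s,t}\,dt)$ with $\psi_{s,s}=x$, and $\psi^{\pi}_{s,t}(x,Q)$ solves the same equation with $\phi_{s,t}(Q)$ replaced by $\pi(\phi^{\pi}_{s,t}(Q))$. *)

(* Defs.v *)
From HB Require Import structures.
From mathcomp Require Import all_boot all_order all_algebra.
From mathcomp Require Import all_classical all_reals all_analysis.

Set Implicit Arguments.
Unset Strict Implicit.
Unset Printing Implicit Defensive.

Import Order.TTheory GRing.Theory Num.Theory.
Import numFieldNormedType.Exports.

Local Open Scope classical_set_scope.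
Local Open Scope ring_scope.

Section Matrices.
Context {K : realType}.

Definition vnorm2 n (x : 'cV[K]_n) : K := Num.sqrt (\sum_(i < n) x i 0 ^+ 2).

(* Operator norm induced by the Euclidean norm. *)
Definition spectral_norm m n (M : 'M[K]_(m, n)) : K :=
  sup [set vnorm2 (M *m x) | x in [set x : 'cV[K]_n | vnorm2 x <= 1]].

Definition psd n (Q : 'M[K]_n) : Prop :=
  Q^T = Q /\ forall x : 'cV[K]_n, 0 <= (x^T *m Q *m x) 0 0.

Definition posdef n (Q : 'M[K]_n) : Prop :=
  Q^T = Q /\ forall x : 'cV[K]_n, x != 0 -> 0 < (x^T *m Q *m x) 0 0.

Definition loewner_le n (M N : 'M[K]_n) : Prop := psd (N - M).

Definition psd_sqrt n (H M : 'M[K]_n) : Prop := psd H /\ H *m H = M.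

Definition controllable n m (A : 'M[K]_n) (B : 'M[K]_(n, m)) : Prop :=
  \rank (\mxrow_(i < n) (A ^+ i *m B)) = n.

Definition observable n m (A : 'M[K]_n) (C : 'M[K]_(m, n)) : Prop :=
  \rank (\mxcol_(i < n) (C *m A ^+ i)) = n.

(* A unit is not required to be part of the ring. *)
Definition matrix_ring n (B : {pred 'M[K]_n}) : Prop :=
  GRing.zmod_closed B /\ GRing.mulr_2closed B.

Definition positive_map n (f : 'M[K]_n -> 'M[K]_n) : Prop :=
  forall Q, psd Q -> psd (f Q).

(* M attains the least value of f on B for the Loewner order; uniqueness of
   the minimizer is not required. *)
Definition loewner_argmin n m (B : {pred 'M[K]_n}) (f : 'M[K]_n -> 'M[K]_m)
    (M : 'M[K]_n) : Prop :=
  M \in B /\ forall N, N \in B -> loewner_le (f M) (f N).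

End Matrices.

Section RiccatiFlows.
Context {K : realType} {n : nat}.
Implicit Types (A S R Q : 'M[K]_n).

Definition Ricc A S R Q : 'M[K]_n :=
  A *m Q + Q *m A^T - Q *m S *m Q + R.

Definition Ricc_pi (pi : 'M[K]_n -> 'M[K]_n) A S R Q : 'M[K]_n :=
  (A - pi Q *m S) *m Q + Q *m (A - pi Q *m S)^T + R + pi Q *m S *m pi Q.

(* Only the restriction of f to [0, +oo[ matters: two-sided derivative at
   positive times, right-continuity at time 0. *)
Definition ode_solution (F : 'M[K]_n -> 'M[K]_n) Q (f : K -> 'M[K]_n) : Prop :=
  [/\ f 0 = Q,
      {within `[0, +oo[, continuous f} &
      forall t : K, 0 < t -> is_derive t 1 f (F (f t))].

Definition psd_flow (F : 'M[K]_n -> 'M[K]_n) (phi : K -> 'M[K]_n -> 'M[K]_n) :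
    Prop :=
  forall Q, psd Q -> ode_solution F Q (phi ^~ Q).

End RiccatiFlows.

Section Processes.
Context {K : realType} {d : measure_display} {Omega : measurableType d}.
Variable P : probability Omega K.

Definition random_vector n (Z : Omega -> 'cV[K]_n) : Prop :=
  forall i, measurable_fun [set: Omega] (fun w => Z w i 0).

Definition continuous_process n (s : K) (Z : K -> Omega -> 'cV[K]_n) : Prop :=
  (forall t, s <= t -> random_vector (Z t)) /\
  {ae P, forall w, {within `[s, +oo[, continuous (fun t => Z t w)}}.

(* [normal_prob m 0] is not the Dirac mass at m, so the degenerate case is
   treated separately. *)
Definition gaussian_rv (f : Omega -> K) : Prop :=
  exists m : K,
    (forall E : set K, measurable E -> P (f @^-1` E) = \d_m E) \/
    (exists2 sd : K, 0 < sd &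
      forall E : set K, measurable E -> P (f @^-1` E) = normal_prob m sd E).

Definition gaussian_vector n (Z : Omega -> 'cV[K]_n) : Prop :=
  random_vector Z /\
  forall a : 'cV[K]_n, gaussian_rv (fun w => (a^T *m Z w) 0 0).

Definition sigma_gen (I : Type) (D : set I) (f : I -> Omega -> K) :
    set (set Omega) :=
  <<s [set F | exists i (E : set K), [/\ D i, measurable E & F = f i @^-1` E]] >>.

Definition independent_vector_process n m (Z : Omega -> 'cV[K]_n)
    (B : K -> Omega -> 'cV[K]_m) : Prop :=
  forall E F : set Omega,
    sigma_gen [set: 'I_n] (fun i w => Z w i 0) E ->
    sigma_gen [set ti : K * 'I_m | 0 <= ti.1]
      (fun ti w => B ti.1 w ti.2 0) F ->
    P (E `&` F) = (P E * P F)%E.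

(* The product formula says at once that the increments over successive
   intervals and their coordinates are mutually independent, and that each
   has law N(0, length of the interval). *)
Definition brownian_motion n (B : K -> Omega -> 'cV[K]_n) : Prop :=
  [/\ continuous_process 0 B,
      {ae P, forall w, B 0 w = 0} &
      forall (N : nat) (u : nat -> K), 0 <= u 0%N ->
        (forall k, (k < N)%N -> u k < u k.+1) ->
      forall E : 'I_n -> 'I_N -> set K, (forall i k, measurable (E i k)) ->
        P [set w | forall (i : 'I_n) (k : 'I_N),
                     E i k ((B (u k.+1) w - B (u k) w) i 0)] =
        (\prod_(i < n) \prod_(k < N)
           normal_prob 0 (Num.sqrt (u k.+1 - u k)) (E i k))%E].

Definition vint n (s t : K) (f : K -> 'cV[K]_n) : 'cV[K]_n :=
  \col_i Rintegral lebesgue_measure `[s, t] (fun u => f u i 0).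

Definition partition_mesh (s t delta : K) (N : nat) (u : nat -> K) : Prop :=
  [/\ u 0%N = s, u N = t &
      forall k, (k < N)%N -> u k <= u k.+1 /\ u k.+1 - u k <= delta].

(* Ito integral of a continuous deterministic integrand G against the
   continuous semimartingale Y on [s, t], determined up to a null event as the
   limit in probability of left-point Riemann sums as the mesh tends to 0. *)
Definition ito_integral m n (G : K -> 'M[K]_(m, n)) (Y : K -> Omega -> 'cV[K]_n)
    (s t : K) (Z : Omega -> 'cV[K]_m) : Prop :=
  random_vector Z /\
  forall eps eta : K, 0 < eps -> 0 < eta ->
  exists2 delta : K, 0 < delta &
  forall (N : nat) (u : nat -> K), partition_mesh s t delta N u ->
    (P [set w | (eps <= vnorm2 (Z w -
         \sum_(k < N) G (u k) *m (Y (u k.+1) w - Y (u k) w)))%R] <= eta%:E)%E.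

(* dX_t = A X_t dt + H dW_t with H = R^{1/2}; the noise being additive, the
   stochastic integral of the constant H is H W_t. *)
Definition signal_process n (A H : 'M[K]_n) (W X : K -> Omega -> 'cV[K]_n) :
    Prop :=
  continuous_process 0 X /\
  {ae P, forall w, forall t, 0 <= t ->
    X t w = X 0 w + vint 0 t (fun u => A *m X u w) + H *m W t w}.

Definition observation_process n m (C : 'M[K]_(m, n)) (H : 'M[K]_m)
    (V : K -> Omega -> 'cV[K]_m) (X : K -> Omega -> 'cV[K]_n)
    (Y : K -> Omega -> 'cV[K]_m) : Prop :=
  continuous_process 0 Y /\
  {ae P, forall w, forall t, 0 <= t ->
    Y t w = vint 0 t (fun u => C *m X u w) + H *m V t w}.

(* dpsi_t = A psi_t dt + Gam_t C' Sigma^{-1} (dY_t - C psi_t dt), psi_s = x *)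
Definition filter_solution n m (A : 'M[K]_n) (C : 'M[K]_(m, n))
    (Sigma : 'M[K]_m) (Y : K -> Omega -> 'cV[K]_m) (Gam : K -> 'M[K]_n)
    (s : K) (x : 'cV[K]_n) (psi : K -> Omega -> 'cV[K]_n) : Prop :=
  let G u := Gam u *m C^T *m invmx Sigma in
  continuous_process s psi /\
  exists J : K -> Omega -> 'cV[K]_n,
    (forall t, s <= t -> ito_integral G Y s t (J t)) /\
    {ae P, forall w, forall t, s <= t ->
      psi t w = x + vint s t (fun u => A *m psi u w - G u *m C *m psi u w)
                + J t w}.

End Processes.

(* Main.v *)
Require Import Defs.
From HB Require Import structures.
From mathcomp Require Import all_boot all_order all_algebra.
From mathcomp Require Import all_classical all_reals all_analysis.
From mathcomp Require Import measurable_realfun ring lra.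

(** Perturbing the minimizer [pi Q] along the ring shows that [pi] satisfies
    [pi (b Q + Q b') = pi (b (pi Q) + (pi Q) b')] for symmetric [Q] and [b] in the
    ring. Hence [pi (phipi_t Q)] solves the Riccati equation issued from [pi Q],
    and so does [phipi_t (pi Q)], because the ring is invariant under the Riccati
    flow and the two vector fields agree on it. Local Lipschitz uniqueness gives
    the first identity and the equality of the gains of the two filters. The Ito
    integrals of equal gains agree almost surely, at all rational times hence by
    continuity at all times, and the difference of the two filters solves a
    homogeneous linear Volterra equation.

    For the exponential estimate put [p = phi_t (pi Q)]. The difference
    [D = phipi_t Q - p] satisfies [D' = (A - p S) D + D (A - p S)^T], and
    [D = phi_t Q - p] satisfies the same equation with the extra term [- D S D].
    All bounds come from one barrier principle: a symmetric curve [F] with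
    [F 0 > 0] stays nonnegative if [x' F' x > 0] whenever [F >= 0], [F x = 0] and
    [x <> 0]. Applied to [h W^-1 - p] and [g (p + eta) - u D], it yields an upper
    bound [p <= M0 + M exp (- rho t)] with [M0] and [rho] independent of the
    initial condition, and the decay of [D], where [u = M0 exp (rho t) + M] (the
    positivity of [R] is what makes the rate positive). Here [W > 0] solves the
    Lyapunov equation [A^T W + W A = S - lam W]; it is definite by observability. *)

Set Implicit Arguments.
Unset Strict Implicit.
Unset Printing Implicit Defensive.

Import Order.TTheory GRing.Theory Num.Theory.
Import numFieldNormedType.Exports.

Local Open Scope classical_set_scope.
Local Open Scope ring_scope.

(** * Quadratic forms, semidefinite matrices and the least eigenvalue *)

Section QuadraticForms.
Context {K : realType}.

Definition dot n (x y : 'cV[K]_n) : K := (x^T *m y) 0 0.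

Lemma dotE n (x y : 'cV[K]_n) : dot x y = \sum_i x i 0 * y i 0.
Proof. by rewrite /dot mxE; apply: eq_bigr => i _; rewrite mxE. Qed.

Lemma dotC n (x y : 'cV[K]_n) : dot x y = dot y x.
Proof. by rewrite !dotE; apply: eq_bigr => i _; rewrite mulrC. Qed.

Lemma dotDl n (x y z : 'cV[K]_n) : dot (x + y) z = dot x z + dot y z.
Proof. by rewrite /dot linearD mulmxDl mxE. Qed.

Lemma dotDr n (x y z : 'cV[K]_n) : dot x (y + z) = dot x y + dot x z.
Proof. by rewrite /dot mulmxDr mxE. Qed.

Lemma dotNl n (x y : 'cV[K]_n) : dot (- x) y = - dot x y.
Proof. by rewrite /dot linearN mulNmx mxE. Qed.

Lemma dotNr n (x y : 'cV[K]_n) : dot x (- y) = - dot x y.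
Proof. by rewrite /dot mulmxN mxE. Qed.

Lemma dotZl n c (x y : 'cV[K]_n) : dot (c *: x) y = c * dot x y.
Proof. by rewrite /dot linearZ -scalemxAl mxE. Qed.

Lemma dotZr n c (x y : 'cV[K]_n) : dot x (c *: y) = c * dot x y.
Proof. by rewrite /dot -scalemxAr mxE. Qed.

Definition dot_lin := (dotDl, dotDr, dotNl, dotNr, dotZl, dotZr).

Lemma dot0r n (x : 'cV[K]_n) : dot x 0 = 0.
Proof. by rewrite /dot mulmx0 mxE. Qed.

Lemma dot0l n (x : 'cV[K]_n) : dot 0 x = 0.
Proof. by rewrite dotC dot0r. Qed.

Lemma dot_mulmxl m n (A : 'M[K]_(m, n)) x y :
  dot (A *m x) y = dot x (A^T *m y).
Proof. by rewrite /dot trmx_mul mulmxA. Qed.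

Lemma dot_mulmxr m n (A : 'M[K]_(m, n)) x y :
  dot x (A *m y) = dot (A^T *m x) y.
Proof. by rewrite dot_mulmxl trmxK. Qed.

Lemma dot_sym n (A : 'M[K]_n) x y : A^T = A -> dot x (A *m y) = dot y (A *m x).
Proof. by move=> sA; rewrite dotC dot_mulmxl sA. Qed.

Lemma quadE n (A : 'M[K]_n) x : (x^T *m A *m x) 0 0 = dot x (A *m x).
Proof. by rewrite /dot mulmxA. Qed.

Lemma dot_ge0 n (x : 'cV[K]_n) : 0 <= dot x x.
Proof. by rewrite dotE sumr_ge0// => i _; rewrite -expr2 sqr_ge0. Qed.

Lemma dot_eq0 n (x : 'cV[K]_n) : (dot x x == 0) = (x == 0).
Proof.
apply/idP/eqP => [|->]; last by rewrite dot0r.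
rewrite dotE psumr_eq0 => [/allP h|i _]; last by rewrite -expr2 sqr_ge0.
apply/matrixP => i j; rewrite ord1 mxE.
by have := h i (mem_index_enum i); rewrite -expr2 sqrf_eq0 => /eqP.
Qed.

Lemma dot_gt0 n (x : 'cV[K]_n) : x != 0 -> 0 < dot x x.
Proof. by move=> x0; rewrite lt_def dot_eq0 x0 dot_ge0. Qed.

(** The sum of the moduli of the entries suffices, since |x_i x_j| <= (x_i^2 + x_j^2) / 2 <= x'x. *)
Lemma dot_bound n (A : 'M[K]_n) :
  exists2 a, 0 <= a & forall x, `|dot x (A *m x)| <= a * dot x x.
Proof.
exists (\sum_i \sum_j `|A i j|) => [|x].
  by apply: sumr_ge0 => i _; apply: sumr_ge0.
have le_dot i : x i 0 ^+ 2 <= dot x x.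
  rewrite dotE (bigD1 i)//= -expr2 lerDl sumr_ge0// => j _.
  by rewrite -expr2 sqr_ge0.
rewrite dotE mulr_suml (le_trans (ler_norm_sum _ _ _))// ler_sum// => i _.
rewrite mxE mulr_sumr mulr_suml (le_trans (ler_norm_sum _ _ _))// ler_sum// => j _.
rewrite mulrCA normrM ler_wpM2l// normrM.
have := le_dot i; have := le_dot j.
rewrite -(real_normK (num_real (x i 0))) -(real_normK (num_real (x j 0))).
have := sqr_ge0 (`|x i 0| - `|x j 0|); lra.
Qed.

Lemma psd_dot n (Q : 'M[K]_n) :
  psd Q <-> Q^T = Q /\ forall x, 0 <= dot x (Q *m x).
Proof.
by split => -[sQ h]; split => // x; have := h x; rewrite quadE.
Qed.

Lemma posdef_dot n (Q : 'M[K]_n) :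
  posdef Q <-> Q^T = Q /\ forall x, x != 0 -> 0 < dot x (Q *m x).
Proof.
by split => -[sQ h]; split => // x; have := h x; rewrite quadE.
Qed.

Lemma posdef_psd n (Q : 'M[K]_n) : posdef Q -> psd Q.
Proof.
move=> /posdef_dot[sQ h]; apply/psd_dot; split => // x.
by have [->|/h/ltW//] := eqVneq x 0; rewrite dot0l.
Qed.

(** At e = c / (b + 1) the expression equals - c^2 / (b + 1)^2. This is the first-order condition
    behind [psd_ker] and behind the optimality argument for [pi]; the denominator b + 1 also covers
    b = 0. *)
Lemma lin_coef_eq0 (b c : K) : 0 <= b ->
  (forall e, 0 <= e ^+ 2 * b - e * c) -> c = 0.
Proof.
move=> b0 /(_ (c / (b + 1))).
have b1 : b + 1 != 0 by rewrite gt_eqF// ltr_wpDl.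
have e0 : c / (b + 1) * (b + 1) = c by rewrite divfK.
set e := c / (b + 1) in e0 *; move=> he.
have : 0 <= (e ^+ 2 * b - e * c) * (b + 1) ^+ 2 by rewrite mulr_ge0// sqr_ge0.
have -> : (e ^+ 2 * b - e * c) * (b + 1) ^+ 2 =
  (e * (b + 1)) ^+ 2 * b - e * (b + 1) * c * (b + 1) by ring.
rewrite e0 => hc; apply/eqP; rewrite -sqrf_eq0 eq_le sqr_ge0 andbT.
have : 0 <= c ^+ 2 * b by rewrite mulr_ge0// sqr_ge0.
have := sqr_ge0 c; lra.
Qed.

(** With y = Q x, the form at x - e y is e^2 y'Q y - 2 e y'y, so its linear coefficient vanishes. *)
Lemma psd_ker n (Q : 'M[K]_n) x : psd Q -> dot x (Q *m x) = 0 -> Q *m x = 0.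
Proof.
move=> /psd_dot[sQ h] x0; apply/eqP; rewrite -dot_eq0; apply/eqP.
set y := Q *m x; have yx : dot y (Q *m x) = dot y y by [].
have xy : dot x (Q *m y) = dot y y by rewrite dot_sym.
pose b := dot y (Q *m y); have b0 : 0 <= b by exact: h.
suff : 2 * dot y y = 0 by lra.
apply: (lin_coef_eq0 b0) => e; have := h (x - e *: y).
by rewrite mulmxBr -!scalemxAr !dot_lin x0 xy yx -/b; lra.
Qed.

Lemma psd_anti n (Q : 'M[K]_n) :
  Q^T = Q -> (forall x, dot x (Q *m x) = 0) -> Q = 0.
Proof.
move=> sQ h.
have pQ : psd Q by apply/psd_dot; split => // x; rewrite h.
apply/matrixP => i j; have := psd_ker pQ (h (delta_mx j 0)).
by rewrite -colE => /matrixP/(_ i 0); rewrite !mxE.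
Qed.


Lemma cvg_sumr (T I : Type) (F : set_system T) {FF : Filter F} (r : seq I)
    (f : I -> T -> K) (a : I -> K) : (forall i, f i x @[x --> F] --> a i) ->
  \sum_(i <- r) f i x @[x --> F] --> \sum_(i <- r) a i.
Proof. by move=> fa; apply: cvg_big => //; exact: add_continuous. Qed.

(** Joint continuity in time and vector allows compactness arguments on the product of a time
    interval and the sphere. *)
Lemma quad_continuous n (F : K -> 'M[K]_n) :
  (forall i j, continuous (fun t => F t i j)) ->
  continuous (fun p : K * 'rV[K]_n => dot p.2^T (F p.1 *m p.2^T)).
Proof.
move=> cF; have coord (i : 'I_n) : continuous (fun p : K * 'rV[K]_n => p.2 0 i).
  move=> p; apply: (@continuous_comp _ _ _ snd (fun v : 'rV[K]_n => v 0 i)).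
    exact: cvg_snd.
  exact: coord_continuous.
rewrite (_ : (fun p => _) =
    fun p : K * 'rV[K]_n => \sum_i p.2 0 i * \sum_j F p.1 i j * p.2 0 j); last first.
  apply/funext => p; rewrite dotE; apply: eq_bigr => i _; rewrite !mxE.
  by congr (_ * _); apply: eq_bigr => j _; rewrite !mxE.
move=> p; apply: cvg_sumr => i; apply: cvgM; first exact: coord.
apply: cvg_sumr => j; apply: cvgM; last exact: coord.
apply: (@continuous_comp _ _ _ fst (fun t => F t i j)); last exact: cF.
exact: cvg_fst.
Qed.

Lemma quad_cst_continuous n (A : 'M[K]_n) :
  continuous (fun p : K * 'rV[K]_n => dot p.2^T (A *m p.2^T)).
Proof. by apply: (@quad_continuous n (fun=> A)) => i j x; exact: cvg_cst. Qed.

(** Row vectors are those of the compactness criterion used below. The sphere is Euclidean, while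
    the norm of the space is the maximum of the entries. *)
Definition sphere n : set 'rV[K]_n := [set v | dot v^T v^T = 1].

Lemma compact_sphere n : compact (@sphere n).
Proof.
have cF : continuous (fun v : 'rV[K]_n => dot v^T v^T).
  rewrite (_ : (fun v => _) = fun v : 'rV[K]_n => \sum_i v 0 i * v 0 i).
    by move=> v; apply: (@cvg_sumr 'rV[K]_n _ (nbhs v)) => i; apply: cvgM; exact: coord_continuous.
  by apply/funext => v; rewrite dotE; apply: eq_bigr => i _; rewrite mxE.
apply: bounded_closed_compact.
  exists 1; split => // M M1 v /= v1.
  rewrite [leLHS]/Num.Def.normr/= mx_normrE; apply: bigmax_le => [|ij _].
    by rewrite (le_trans ler01)// ltW.
  have : `|v ij.1 ij.2| ^+ 2 <= 1.
    rewrite real_normK ?num_real// -v1 dotE (ord1 ij.1) (bigD1 ij.2)//= !mxE.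
    rewrite -expr2 lerDl sumr_ge0// => j _.
    by rewrite -expr2 sqr_ge0.
  by rewrite expr_le1// => /le_trans; apply; exact: ltW.
rewrite /sphere (_ : [set v | _] = (fun v : 'rV[K]_n => dot v^T v^T) @^-1` [set 1]) //.
by apply: closed_comp => [v _|]; [exact: cF|exact: closed_eq].
Qed.

Lemma sphereZ n (x : 'cV[K]_n) : x != 0 ->
  sphere (((Num.sqrt (dot x x))^-1 *: x)^T).
Proof.
move=> x0; rewrite /sphere /= trmxK !dot_lin mulrA -invfM -expr2.
by rewrite sqr_sqrtr ?dot_ge0// mulVf// dot_eq0.
Qed.

(** If m is the minimum of the form on the sphere, W - m is semidefinite and its form vanishes at
    the minimizer, which therefore lies in its kernel. *)
Lemma rayleigh n (W : 'M[K]_n.+1) : W^T = W ->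
  exists m (x : 'cV[K]_n.+1), [/\ x != 0, W *m x = m *: x &
    forall y, m * dot y y <= dot y (W *m y)].
Proof.
move=> sW.
have cW := @quad_cst_continuous _ W.
(* The factor reduced to 0 is a dummy time, so that the continuity result for pairs applies. *)
have cS : compact ([set 0 : K] `*` @sphere n.+1).
  by apply: compact_setX; [exact: compact_set1|exact: compact_sphere].
pose e : 'cV[K]_n.+1 := delta_mx 0 0.
have e0 : e != 0.
  by apply/eqP => /matrixP/(_ 0 0); rewrite !mxE !eqxx => /eqP; rewrite oner_eq0.
have [|p +] := compact_EVT_min _ cS (continuous_subspaceT cW).
  by exists (0, ((Num.sqrt (dot e e))^-1 *: e)^T);
    split => //; exact: sphereZ.
rewrite inE => -[_ /= p1] hm.
set m := dot p.2^T (W *m p.2^T) in hm; exists m, p.2^T.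
have lem y : m * dot y y <= dot y (W *m y).
  have [->|y0] := eqVneq y 0; first by rewrite mulmx0 !dot0r mulr0.
  have := hm (0, ((Num.sqrt (dot y y))^-1 *: y)^T).
  rewrite inE /= => /(_ (conj erefl (sphereZ y0))).
  rewrite trmxK -scalemxAr !dot_lin mulrA -invfM -expr2 sqr_sqrtr ?dot_ge0//.
  by rewrite -ler_pdivlMr ?dot_gt0// mulrC.
split => //.
  apply/eqP => x0; move: p1; rewrite /sphere /= x0 dot0r => /eqP.
  by rewrite eq_sym oner_eq0.
apply/eqP; rewrite -subr_eq0 -mul_scalar_mx -mulmxBl; apply/eqP/psd_ker.
  apply/psd_dot; split; first by rewrite linearB /= sW tr_scalar_mx.
  by move=> y; rewrite mulmxBl mul_scalar_mx !dot_lin subr_ge0.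
by rewrite mulmxBl mul_scalar_mx !dot_lin -/m p1 mulr1 subrr.
Qed.

Lemma posdef_lb n (W : 'M[K]_n) : posdef W ->
  exists2 m, 0 < m & forall y, m * dot y y <= dot y (W *m y).
Proof.
case: n W => [W _|n W /posdef_dot[sW pW]].
  by exists 1 => // y; rewrite (flatmx0 y) mulmx0 !dot0r mulr0.
have [m [x [x0 Wx h]]] := rayleigh sW; exists m => //.
by have := pW _ x0; rewrite Wx dotZr pmulr_lgt0// dot_gt0.
Qed.

Lemma posdef_unit n (W : 'M[K]_n) : posdef W -> W \in unitmx.
Proof.
move=> /posdef_dot[sW pW]; rewrite -row_free_unit -kermx_eq0.
apply/eqP/row_matrixP => i; rewrite row0; apply/eqP; rewrite -trmx_eq0.
apply/negP => /negP/pW; rewrite dot_mulmxr sW.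
have : row i (kermx W) *m W = 0 by rewrite -row_mul mulmx_ker row0.
by move=> /(congr1 trmx); rewrite trmx_mul sW linear0 => ->; rewrite dot0l ltxx.
Qed.

Lemma posdef_inv n (W : 'M[K]_n) : posdef W -> posdef (invmx W).
Proof.
move=> pW; have uW := posdef_unit pW; move/posdef_dot: pW => [sW pW].
apply/posdef_dot; split => [|x x0]; first by rewrite trmx_inv sW.
have {1}-> : x = W *m (invmx W *m x) by rewrite mulmxA mulmxV// mul1mx.
rewrite dot_mulmxl sW; apply: pW; apply: contraNneq x0 => h.
by rewrite -(mul1mx x) -(mulmxV uW) -mulmxA h mulmx0.
Qed.

End QuadraticForms.

(** * The Lyapunov equation and observability *)

Section Lyapunov.
Context {K : realType}.

(** Dimension count; it solves the Lyapunov equation without integrating a matrix exponential. *)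
Lemma linear_inj_surj m n (f : {linear 'M[K]_(m, n) -> 'M[K]_(m, n)}) :
  (forall X, f X = 0 -> X = 0) -> forall Y, exists X, f X = Y.
Proof.
move=> f0 Y; pose L := lin_mx f.
have uL : L \in unitmx.
  rewrite -row_free_unit -kermx_eq0; apply/eqP/row_matrixP => i; rewrite row0.
  have : row i (kermx L) *m L = 0 by rewrite -row_mul mulmx_ker row0.
  rewrite -(vec_mxK (row i (kermx L))) mul_vec_lin => h.
  by rewrite (f0 _ (can_inj mxvecK (etrans h (esym (linear0 _))))) linear0.
exists (vec_mx (mxvec Y *m invmx L)); apply: (can_inj mxvecK).
by rewrite -mul_vec_lin vec_mxK -mulmxA mulVmx// mulmx1.
Qed.

Lemma mxtrace_quad m n (A : 'M[K]_m) (Y : 'M[K]_(m, n)) :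
  \tr (Y^T *m (A *m Y)) = \sum_j dot (col j Y) (A *m col j Y).
Proof.
rewrite /mxtrace; apply: eq_bigr => j _; rewrite !mxE dotE; apply: eq_bigr => i _.
by rewrite !mxE; congr (_ * _); apply: eq_bigr => k _; rewrite !mxE.
Qed.

(** Summing over the columns of [Y] transfers a bound on vectors to the Frobenius product. *)
Lemma mxtrace_quad_bound m n (A : 'M[K]_m) (Y : 'M[K]_(m, n)) a :
  (forall x, `|dot x (A *m x)| <= a * dot x x) ->
  `|\tr (Y^T *m (A *m Y))| <= a * \tr (Y^T *m Y).
Proof.
move=> ha; have -> : \tr (Y^T *m Y) = \tr (Y^T *m (1%:M *m Y)) by rewrite mul1mx.
rewrite !mxtrace_quad mulr_sumr (le_trans (ler_norm_sum _ _ _))// ler_sum// => j _.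
by rewrite mul1mx.
Qed.

Lemma mxtrace_sq_ge0 m n (Y : 'M[K]_(m, n)) : 0 <= \tr (Y^T *m Y).
Proof.
have -> : Y^T *m Y = Y^T *m (1%:M *m Y) by rewrite mul1mx.
by rewrite mxtrace_quad sumr_ge0// => j _; rewrite mul1mx dot_ge0.
Qed.

Lemma mxtrace_sq_eq0 m n (Y : 'M[K]_(m, n)) : \tr (Y^T *m Y) = 0 -> Y = 0.
Proof.
have -> : Y^T *m Y = Y^T *m (1%:M *m Y) by rewrite mul1mx.
rewrite mxtrace_quad => /eqP; rewrite psumr_eq0 => [/allP h|j _]; last first.
  by rewrite mul1mx dot_ge0.
apply/matrixP => i j; have /eqP/matrixP/(_ i 0) : col j Y == 0.
  by rewrite -dot_eq0 -[X in dot _ X]mul1mx; exact: h (mem_index_enum _).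
by rewrite !mxE.
Qed.

Lemma observable_ker n m (A : 'M[K]_n) (C : 'M[K]_(m, n)) (x : 'cV[K]_n) :
  observable A C -> (forall k, C *m A ^+ k *m x = 0) -> x = 0.
Proof.
rewrite /observable; set O := \mxcol_(i < n) _ => /eqP fO h.
have /row_fullP[D DO] : row_full O by [].
rewrite -(mul1mx x) -DO -mulmxA (_ : O *m x = 0) ?mulmx0//.
apply/mxcolP => i; rewrite -submxcol_mul mxcolK submxcol0; exact: h.
Qed.

(** At an eigenvector x of the least eigenvalue mu, the equation gives mu (lam x'x + 2 x'A x) = x'S
    x >= 0, and the factor of mu is positive. *)
Lemma lyapunov_psd n (A S W : 'M[K]_n) lam : W^T = W ->
  (forall x, 0 <= dot x (S *m x)) ->
  (forall x, x != 0 -> 0 < lam * dot x x + 2 * dot x (A *m x)) ->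
  A^T *m W + W *m A + lam *: W = S -> psd W.
Proof.
case: n A S W => [|n] A S W sW pS pA WE.
  by apply/psd_dot; split => // x; rewrite (flatmx0 x) dot0l.
have [mu [x [x0 Wx hm]]] := rayleigh sW.
apply/psd_dot; split => // y; apply: le_trans (hm y).
rewrite mulr_ge0 ?dot_ge0//.
have := pS x; rewrite -WE !mulmxDl -scalemxAl -!mulmxA Wx !dot_lin -scalemxAr dotZr.
rewrite dotC dot_mulmxl trmxK [dot x (W *m _)]dot_sym// Wx dotZr [dot (A *m x) x]dotC.
have h := pA _ x0 => h3; rewrite leNgt; apply/negP => mu0.
have : mu * (lam * dot x x + 2 * dot x (A *m x)) < 0 by rewrite nmulr_rlt0.
lra.
Qed.

(* The solution [W] is the discounted observability Gramian
   [\int_0^oo exp(-lam s) exp(-s A)^T S exp(-s A) ds]. *)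
Lemma observable_lyapunov n m (A : 'M[K]_n) (C : 'M[K]_(m, n)) (S : 'M[K]_n) :
  observable A C -> psd S -> (forall x : 'cV_n, S *m x = 0 -> C *m x = 0) ->
  exists lam W, [/\ 0 < lam, posdef W & A^T *m W + W *m A = S - lam *: W].
Proof.
move=> obs /psd_dot[sS pS] SC; have [a a0 ha] := dot_bound A.
(* Since lam > 2 a, the discount dominates [A]: this makes [T] injective and provides the positivity
   required by [lyapunov_psd]. *)
pose lam := 2 * a + 1; have lam0 : 0 < lam by rewrite /lam; lra.
pose T := mulmx A^T \+ mulmxr (A + lam%:M) : 'M[K]_n -> 'M[K]_n.
have TE X : T X = A^T *m X + X *m A + lam *: X.
  by rewrite /T /= mulmxDr mul_mx_scalar addrA.
(* The trace product of X and T X is at least (lam - 2 a) tr(X'X) = tr(X'X). *)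
have T0 X : T X = 0 -> X = 0.
  rewrite TE => TX; apply: mxtrace_sq_eq0.
  have haT x : `|dot x (A^T *m x)| <= a * dot x x.
    by rewrite dotC dot_mulmxl trmxK; exact: ha.
  have := mxtrace_quad_bound X haT; have := mxtrace_quad_bound X^T ha.
  rewrite trmxK (mulmxA X A) !(mxtrace_mulC _ X^T).
  have : \tr (X^T *m (A^T *m X + X *m A + lam *: X)) = 0.
    by rewrite TX mulmx0 mxtrace0.
  rewrite !mulmxDr !mxtraceD -scalemxAr mxtraceZ.
  have := mxtrace_sq_ge0 X; move: (\tr (X^T *m X)) => t t0 h.
  rewrite !ler_norml => /andP[h1 _] /andP[h2 _].
  apply/eqP; rewrite eq_le t0 andbT; move: h; rewrite /lam; lra.
have [W WE] := @linear_inj_surj n n (mulmx A^T \+ mulmxr (A + lam%:M)) T0 S.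
have {}WE : T W = S by exact: WE.
(* As S is symmetric, the transpose of [W] solves the same equation, and [T] is injective. *)
have sW : W^T = W.
  have TtW : T W = T W^T.
    rewrite -[LHS]trmxK {1}WE sS -WE !TE !linearD /= !trmx_mul trmxK linearZ /=.
    by rewrite (addrC (W^T *m A)).
  apply/esym/eqP; rewrite -subr_eq0; apply/eqP/T0; move: TtW; rewrite !TE => e.
  rewrite mulmxBr mulmxBl scalerBr [X in X + _]addrACA.
  by rewrite -opprD addrACA -opprD e subrr.
rewrite TE in WE.
have pW : psd W.
  apply: (lyapunov_psd sW _ _ WE) => [x|]; first exact: pS.
  move=> x x0; have := dot_gt0 x0; have := ha x.
  by rewrite ler_norml => /andP[h1 _] h2; rewrite /lam; nra.
exists lam, W; split => //; last by rewrite -WE addrK.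
(* If W x = 0, the form of S vanishes at x, so S x = 0, and the equation then leaves W A x = 0. The
   kernel of [W] is thus stable under [A] and contained in that of [C]; observability makes it
   trivial. *)
have ker (x : 'cV_n) : W *m x = 0 -> C *m x = 0 /\ W *m (A *m x) = 0.
  move=> Wx; have Sx : S *m x = 0.
    apply: psd_ker; first by apply/psd_dot.
    rewrite -WE !mulmxDl -scalemxAl -!mulmxA Wx !mulmx0 scaler0 !dot_lin.
    by rewrite dot_sym// Wx !dot0r !addr0.
  split; first exact: SC.
  by move: Sx; rewrite -WE !mulmxDl -scalemxAl -!mulmxA Wx mulmx0 scaler0 add0r addr0.
apply/posdef_dot; split => // x x0; rewrite lt_def; move/psd_dot: (pW) => [_ ->].
rewrite andbT; apply: contra x0 => /eqP/(psd_ker pW) Wx.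
apply/eqP/(observable_ker obs) => k; rewrite -mulmxA.
have : W *m (A ^+ k *m x) = 0.
  elim: k => [|k /ker[_ h]]; first by rewrite expr0 mul1mx.
  by rewrite exprS -mulmxE -mulmxA.
by case/ker.
Qed.

End Lyapunov.

(** * Spectral norm and quadratic forms *)

Section SpectralNorm.
Context {K : realType}.

Lemma vnorm2E n (x : 'cV[K]_n) : vnorm2 x = Num.sqrt (dot x x).
Proof. by rewrite /vnorm2 dotE; congr Num.sqrt; apply: eq_bigr => i _; rewrite expr2. Qed.

Lemma sqr_vnorm2 n (x : 'cV[K]_n) : vnorm2 x ^+ 2 = dot x x.
Proof. by rewrite vnorm2E sqr_sqrtr// dot_ge0. Qed.

Lemma vnorm2_ge0 n (x : 'cV[K]_n) : 0 <= vnorm2 x.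
Proof. by rewrite vnorm2E sqrtr_ge0. Qed.

Lemma vnorm2_le n (x : 'cV[K]_n) c : 0 <= c -> (vnorm2 x <= c) = (dot x x <= c ^+ 2).
Proof. by move=> c0; rewrite -sqr_vnorm2 ler_sqr// nnegrE// vnorm2_ge0. Qed.

Lemma dot_CS n (u v : 'cV[K]_n) : dot u v ^+ 2 <= dot u u * dot v v.
Proof.
have [->|v0] := eqVneq v 0; first by rewrite !dot0r expr0n mulr0.
have := dot_ge0 (dot v v *: u - dot u v *: v); rewrite !dot_lin (dotC v u).
move=> h; rewrite -subr_ge0 -(pmulr_rge0 _ (dot_gt0 v0)); move: h; lra.
Qed.

Let ball2 m n (M : 'M[K]_(m, n)) :=
  [set vnorm2 (M *m x) | x in [set x : 'cV[K]_n | vnorm2 x <= 1]].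

Lemma ball2_0 m n (M : 'M[K]_(m, n)) : ball2 M 0.
Proof. by exists 0 => /=; rewrite ?mulmx0 vnorm2E dot0r sqrtr0. Qed.

Lemma has_ubound_ball2 m n (M : 'M[K]_(m, n)) : has_ubound (ball2 M).
Proof.
have [a a0 ha] := dot_bound (M^T *m M); exists (Num.sqrt a) => _ [x /= x1 <-].
rewrite vnorm2_le ?sqrtr_ge0// sqr_sqrtr// dot_mulmxl mulmxA.
move: x1; rewrite vnorm2_le// expr1n => x1.
by rewrite (le_trans (ler_norm _))// (le_trans (ha x))// ler_piMr.
Qed.

Lemma spectral_norm_ge0 m n (M : 'M[K]_(m, n)) : 0 <= spectral_norm M.
Proof. by apply: ub_le_sup; [exact: has_ubound_ball2|exact: ball2_0]. Qed.

Lemma spectral_norm_mulmx m n (M : 'M[K]_(m, n)) x :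
  vnorm2 (M *m x) <= spectral_norm M * vnorm2 x.
Proof.
have [->|x0] := eqVneq x 0; first by rewrite mulmx0 !vnorm2E !dot0r sqrtr0 mulr0.
have nx0 : 0 < vnorm2 x by rewrite vnorm2E sqrtr_gt0 dot_gt0.
rewrite -ler_pdivrMr//; apply: ub_le_sup; first exact: has_ubound_ball2.
have nZ k c (y : 'cV[K]_k) : 0 <= c -> vnorm2 (c *: y) = c * vnorm2 y.
  move=> c0; rewrite !vnorm2E !dot_lin mulrA -expr2 sqrtrM ?sqr_ge0//.
  by rewrite sqrtr_sqr ger0_norm.
exists ((vnorm2 x)^-1 *: x) => /=.
  by rewrite nZ ?invr_ge0 ?vnorm2_ge0// mulVf// gt_eqF.
by rewrite -scalemxAr nZ ?invr_ge0 ?vnorm2_ge0// mulrC.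
Qed.

Lemma spectral_norm_dot n (M : 'M[K]_n) x :
  `|dot x (M *m x)| <= spectral_norm M * dot x x.
Proof.
have h0 := mulr_ge0 (spectral_norm_ge0 M) (dot_ge0 x).
rewrite -ler_sqr ?nnegrE// real_normK ?num_real//.
rewrite (le_trans (dot_CS _ _))//.
have -> : (spectral_norm M * dot x x) ^+ 2 =
    dot x x * (spectral_norm M * vnorm2 x) ^+ 2 by rewrite !exprMn sqr_vnorm2; ring.
rewrite ler_wpM2l ?dot_ge0// -sqr_vnorm2 ler_sqr ?nnegrE ?vnorm2_ge0//.
  exact: spectral_norm_mulmx.
by rewrite mulr_ge0 ?spectral_norm_ge0 ?vnorm2_ge0.
Qed.

Lemma spectral_norm_entry m n (M : 'M[K]_(m, n)) i j : `|M i j| <= spectral_norm M.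
Proof.
have e1 : vnorm2 (delta_mx j 0 : 'cV[K]_n) = 1.
  rewrite vnorm2E dotE (bigD1 j)//= !mxE !eqxx mulr1 big1 ?addr0 ?sqrtr1//.
  by move=> k kj; rewrite !mxE (negbTE kj) mul0r.
have := spectral_norm_mulmx M (delta_mx j 0); rewrite e1 mulr1.
apply: le_trans; rewrite -ler_sqr ?nnegrE ?vnorm2_ge0// sqr_vnorm2 -colE.
rewrite dotE (bigD1 i)//= !mxE real_normK ?num_real// -expr2 lerDl sumr_ge0// => k _.
by rewrite -expr2 sqr_ge0.
Qed.

(** Polarization: with y = D x, the forms of [D] at b x + y and b x - y differ by 4 b y'y, and the
    hypothesis bounds this difference by 2 b (b^2 x'x + y'y), whence y'y <= b^2 x'x. The case b = 0
    is apart because of the division by b. *)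
Lemma spectral_norm_sym_le n (D : 'M[K]_n) b : D^T = D -> 0 <= b ->
  (forall x, `|dot x (D *m x)| <= b * dot x x) -> spectral_norm D <= b.
Proof.
move=> sD b0 hb; apply: ge_sup; first by exists 0; exact: ball2_0.
move=> _ [x /= x1 <-]; rewrite vnorm2_le//.
move: x1; rewrite vnorm2_le// expr1n => x1.
set y := D *m x; have [b00|b00] := eqVneq b 0.
  have D0 : D = 0.
    apply: psd_anti => // z; apply/eqP; rewrite -normr_le0 (le_trans (hb z))//.
    by rewrite b00 mul0r.
  by rewrite /y D0 mul0mx dot0r sqr_ge0.
have bgt0 : 0 < b by rewrite lt_def b00.
have := hb (b *: x + y); have := hb (b *: x - y); rewrite !ler_norml.
rewrite !mulmxDr mulmxN -!scalemxAr !dot_lin -/y [dot x (D *m y)]dot_sym// -/y (dotC y x).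
move: (dot y y) (dot y (D *m y)) (dot x y) => Y q p /andP[h1 _] /andP[_ h2].
rewrite -(ler_pM2l bgt0); have : b ^+ 2 * dot x x <= b ^+ 2 by rewrite ler_piMr ?sqr_ge0.
rewrite -(ler_pM2l bgt0); lra.
Qed.

(** Expansion of [Q] on elementary matrices. It will bound the form of [pi Q] through the norm of
    [Q] alone, as the final constant requires. *)
Lemma linear_dot_bound n (f : {linear 'M[K]_n -> 'M[K]_n}) :
  exists2 k, 0 <= k & forall Q x,
    `|dot x (f Q *m x)| <= k * spectral_norm Q * dot x x.
Proof.
have /all_sig2[a a0 ha] := fun ij : 'I_n * 'I_n =>
  cid2 (dot_bound (f (delta_mx ij.1 ij.2))).
exists (\sum_ij a ij) => [|Q x]; first by apply: sumr_ge0.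
rewrite {1}(matrix_sum_delta Q) pair_big linear_sum mulmx_suml /=.
have -> : dot x (\sum_i f (Q i.1 i.2 *: delta_mx i.1 i.2) *m x) =
    \sum_i Q i.1 i.2 * dot x (f (delta_mx i.1 i.2) *m x).
  rewrite /dot mulmx_sumr summxE; apply: eq_bigr => ij _.
  by rewrite linearZ -scalemxAl -scalemxAr mxE.
rewrite (le_trans (ler_norm_sum _ _ _))// !mulr_suml ler_sum// => ij _.
rewrite normrM mulrAC mulrC ler_pM// ?spectral_norm_entry//.
Qed.

End SpectralNorm.

(** * Calculus for matrix-valued curves and Gronwall's inequality *)

Section MatrixCurves.
Context {K : realType}.

(** Entrywise notions reduce matrix calculus to scalar calculus; continuity is one-sided at time 0,
    as in [ode_solution]. *)
Definition mcont m n (f : K -> 'M[K]_(m, n)) :=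
  forall i j, {within `[0, +oo[, continuous (fun t => f t i j)}.

Definition mder m n (f : K -> 'M[K]_(m, n)) (t : K) (df : 'M[K]_(m, n)) :=
  forall i j, is_derive t 1 (fun s => f s i j) (df i j).

Lemma is_derive_sumr (I : Type) (r : seq I) (h : I -> K -> K) (dh : I -> K) (t : K) :
  (forall i, is_derive t 1 (h i) (dh i)) ->
  is_derive t 1 (fun s => \sum_(i <- r) h i s) (\sum_(i <- r) dh i).
Proof.
move=> H; elim: r => [|i r IH].
  rewrite big_nil (_ : (fun s => _) = cst 0); first exact: is_derive_cst.
  by apply/funext => s; rewrite big_nil.
rewrite big_cons (_ : (fun s => _) = h i + fun s => \sum_(i <- r) h i s).
  exact: is_deriveD.
by apply/funext => s; rewrite big_cons.
Qed.

Lemma is_derive_mul (f g : K -> K) (t df dg : K) :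
  is_derive t 1 f df -> is_derive t 1 g dg ->
  is_derive t 1 (fun s => f s * g s) (df * g t + f t * dg).
Proof.
move=> hf hg; have := @is_deriveM _ _ f g t 1 df dg hf hg.
by rewrite addrC /GRing.scale /= (mulrC (g t)).
Qed.

Lemma is_derive_mulr (f : K -> K) (t df c : K) :
  is_derive t 1 f df -> is_derive t 1 (fun s => f s * c) (df * c).
Proof.
move=> hf; have := is_derive_mul hf (is_derive_cst c t 1).
by rewrite mulr0 addr0.
Qed.

Lemma is_derive_expRM (c t : K) :
  is_derive t 1 (fun s => expR (c * s)) (c * expR (c * t)).
Proof.
have h : is_derive t 1 (fun s => s * c) c.
  by have := is_derive_mulr c (is_derive_id t 1); rewrite mul1r.
have := @is_derive1_comp _ expR (fun s => s * c) t _ _ (is_derive_expR _) h.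
rewrite (_ : (fun s => expR (c * s)) = expR \o (fun s => s * c)).
  by rewrite (mulrC c (expR _)) (mulrC c t).
by apply/funext => s; rewrite /= mulrC.
Qed.

Lemma mderD m n (f g : K -> 'M[K]_(m, n)) t df dg :
  mder f t df -> mder g t dg -> mder (fun s => f s + g s) t (df + dg).
Proof.
move=> hf hg i j; rewrite mxE.
rewrite (_ : (fun s => _) = (fun s => f s i j) + (fun s => g s i j)).
  by have := hf i j; have := hg i j => ? ?; exact: is_deriveD.
by apply/funext => s; rewrite mxE.
Qed.

Lemma mderN m n (f : K -> 'M[K]_(m, n)) t df :
  mder f t df -> mder (fun s => - f s) t (- df).
Proof.
move=> hf i j; rewrite mxE.
rewrite (_ : (fun s => _) = - (fun s => f s i j)).
  by have := hf i j => ?; exact: is_deriveN.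
by apply/funext => s; rewrite mxE.
Qed.

Lemma mderB m n (f g : K -> 'M[K]_(m, n)) t df dg :
  mder f t df -> mder g t dg -> mder (fun s => f s - g s) t (df - dg).
Proof. by move=> hf /mderN; exact: mderD. Qed.

Lemma mder_cst m n (M : 'M[K]_(m, n)) t : mder (fun=> M) t 0.
Proof. by move=> i j; rewrite mxE; exact: is_derive_cst. Qed.

Lemma mderZ m n (b : K -> K) (f : K -> 'M[K]_(m, n)) (t db : K) df :
  is_derive t 1 b db -> mder f t df ->
  mder (fun s => b s *: f s) t (b t *: df + db *: f t).
Proof.
move=> hb hf i j; rewrite !mxE.
rewrite (_ : (fun s => _) = fun s => b s * f s i j).
  by rewrite addrC; exact: is_derive_mul (hf i j).
by apply/funext => s; rewrite mxE.
Qed.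

Lemma linear_entry m n p q (L : {linear 'M[K]_(m, n) -> 'M[K]_(p, q)}) M i j :
  L M i j = \sum_k \sum_l M k l * L (delta_mx k l) i j.
Proof.
rewrite {1}(matrix_sum_delta M) linear_sum summxE; apply: eq_bigr => k _.
by rewrite linear_sum summxE; apply: eq_bigr => l _; rewrite linearZ mxE.
Qed.

Lemma mder_linear m n p q (L : {linear 'M[K]_(m, n) -> 'M[K]_(p, q)})
  (f : K -> 'M[K]_(m, n)) t df : mder f t df -> mder (fun s => L (f s)) t (L df).
Proof.
move=> hf i j; rewrite linear_entry.
rewrite (_ : (fun s => _) =
  fun s => \sum_k \sum_l f s k l * L (delta_mx k l) i j); last first.
  by apply/funext => s; rewrite linear_entry.
apply: is_derive_sumr => k; apply: is_derive_sumr => l.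
by apply: is_derive_mulr; exact: hf.
Qed.

Lemma is_derive_quad n (f : K -> 'M[K]_n) (t : K) df x y :
  mder f t df -> is_derive t 1 (fun s => dot x (f s *m y)) (dot x (df *m y)).
Proof.
move=> hf; have := mder_linear (mulmxr y) hf => /(mder_linear (mulmx x^T)) /(_ 0 0).
by [].
Qed.

Lemma mcontD m n (f g : K -> 'M[K]_(m, n)) :
  mcont f -> mcont g -> mcont (fun s => f s + g s).
Proof.
move=> hf hg i j; rewrite (_ : (fun s => _) = fun s => f s i j + g s i j).
  by move=> x; apply: cvgD; [exact: hf|exact: hg].
by apply/funext => s; rewrite mxE.
Qed.

Lemma mcontN m n (f : K -> 'M[K]_(m, n)) : mcont f -> mcont (fun s => - f s).
Proof.
move=> hf i j; rewrite (_ : (fun s => _) = fun s => - f s i j).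
  by move=> x; apply: cvgN; exact: hf.
by apply/funext => s; rewrite mxE.
Qed.

Lemma mcontB m n (f g : K -> 'M[K]_(m, n)) :
  mcont f -> mcont g -> mcont (fun s => f s - g s).
Proof. by move=> hf /mcontN; exact: mcontD. Qed.

Lemma mcont_cst m n (M : 'M[K]_(m, n)) : mcont (fun=> M).
Proof. by move=> i j x; exact: cvg_cst. Qed.

Lemma mcontZ m n (b : K -> K) (f : K -> 'M[K]_(m, n)) :
  {within `[0, +oo[, continuous b} -> mcont f -> mcont (fun s => b s *: f s).
Proof.
move=> hb hf i j; rewrite (_ : (fun s => _) = fun s => b s * f s i j).
  by move=> x; apply: cvgM; [exact: hb|exact: hf].
by apply/funext => s; rewrite mxE.
Qed.

Lemma mcontM m n p (f : K -> 'M[K]_(m, n)) (g : K -> 'M[K]_(n, p)) :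
  mcont f -> mcont g -> mcont (fun s => f s *m g s).
Proof.
move=> hf hg i j; rewrite (_ : (fun s => _) = fun s => \sum_k f s i k * g s k j).
  by move=> x; apply: cvg_sumr => k; apply: cvgM; [exact: hf|exact: hg].
by apply/funext => s; rewrite mxE.
Qed.

Lemma mcont_linear m n p q (L : {linear 'M[K]_(m, n) -> 'M[K]_(p, q)})
  (f : K -> 'M[K]_(m, n)) : mcont f -> mcont (fun s => L (f s)).
Proof.
move=> hf i j; rewrite (_ : (fun s => _) =
  fun s => \sum_k \sum_l f s k l * L (delta_mx k l) i j).
  move=> x; apply: cvg_sumr => k; apply: cvg_sumr => l.
  by apply: cvgM; [exact: hf|exact: cvg_cst].
by apply/funext => s; rewrite linear_entry.
Qed.

Lemma mx_norm_le m n (M : 'M[K]_(m, n)) c : 0 <= c ->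
  (forall i j, `|M i j| <= c) -> `|M| <= c.
Proof.
move=> c0 h; rewrite [leLHS]/Num.Def.normr/= mx_normrE.
by apply: bigmax_le => // ij _; exact: h.
Qed.

Lemma mx_norm_entry m n (M : 'M[K]_(m, n)) i j : `|M i j| <= `|M|.
Proof.
rewrite [leRHS]/Num.Def.normr/= mx_normrE.
exact: (le_bigmax _ (fun ij : 'I_m * 'I_n => `|M ij.1 ij.2|) (i, j)).
Qed.

Lemma mcont_bounded m n (f : K -> 'M[K]_(m, n)) T : mcont f ->
  exists2 b, 0 <= b & forall t, 0 <= t <= T -> `|f t| <= b.
Proof.
move=> hf; have [T0|T0] := ltP T 0.
  by exists 0 => // t /andP[t0 /(le_trans t0)]; rewrite leNgt T0.
have /all_sig2[b b0 hb] : forall ij : 'I_m * 'I_n,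
    {b | 0 <= b & forall t, 0 <= t <= T -> `|f t ij.1 ij.2| <= b}.
  move=> [i j] /=; apply: cid2.
  have cf : {within `[0, T], continuous (fun t => `|f t i j|)}.
    have sub : `[0, T] `<=` `[0 : K, +oo[.
      by move=> t /=; rewrite !in_itv/= andbT => /andP[].
    apply: (continuous_subspaceW sub).
    by move=> x; apply: cvg_norm; exact: hf.
  have [c _ hc] := EVT_max T0 cf.
  by exists `|f c i j| => // t tT; apply: hc; rewrite in_itv.
exists (\sum_ij b ij) => [|t tT]; first exact: sumr_ge0.
apply: mx_norm_le => [|i j]; first exact: sumr_ge0.
rewrite (le_trans (hb (i, j) t tT))// (bigD1 (i, j))//= lerDl.
exact: sumr_ge0.
Qed.

(** Mean value theorem for exp(- L t) g(t), whose derivative is nonpositive inside the interval. *)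
Lemma gronwall (g dg : K -> K) L T : 0 < T ->
  {within `[0, T], continuous g} ->
  (forall t, 0 < t < T -> is_derive t 1 g (dg t)) ->
  (forall t, 0 < t < T -> dg t <= L * g t) -> g T <= expR (L * T) * g 0.
Proof.
move=> T0 cg hg hL.
pose e := fun t : K => expR (- L * t).
have de (t : K) : is_derive t 1 e (- L * e t) by exact: is_derive_expRM.
have [t|t|c] := @MVT _ (fun t => e t * g t)
  (fun t => - L * e t * g t + e t * dg t) 0 T T0.
- by rewrite in_itv/= => tT; apply: is_derive_mul; exact: hg.
- apply: cvgM; last exact: cg.
  apply: continuous_subspaceT => s; apply: differentiable_continuous.
  by apply/derivable1_diffP; have [] := de s.
rewrite in_itv/= => cT; rewrite subr0 => h.
have : e T * g T - e 0 * g 0 <= 0.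
  rewrite h pmulr_lle0// (_ : _ + _ = e c * (dg c - L * g c)); last by ring.
  by rewrite pmulr_rle0 ?expR_gt0// subr_le0; exact: hL.
rewrite /e mulr0 expR0 mul1r subr_le0 mulNr expRN => h0.
by rewrite -ler_pdivrMl ?expR_gt0.
Qed.

End MatrixCurves.

(** * Uniqueness and invariance for matrix differential equations *)

Section MatrixODE.
Context {K : realType}.

Lemma ode_mcont n F Q (f : K -> 'M[K]_n) : ode_solution F Q f -> mcont f.
Proof.
move=> [_ cf _] i j x.
apply: (@continuous_comp _ _ _ (f : subspace _ -> _) (fun M : 'M[K]_n => M i j)).
  exact: cf.
exact: coord_continuous.
Qed.

Lemma ode_mder n F Q (f : K -> 'M[K]_n) (t : K) :
  ode_solution F Q f -> 0 < t -> mder f t (F (f t)).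
Proof.
move=> [_ _ df] /df[dft <-] i j; apply: DeriveDef; first by move/derivable_mxP: dft.
by rewrite derive_mx// mxE.
Qed.

(** The constant may depend on the horizon [T], so that fields which are only locally Lipschitz,
    such as quadratic ones, are covered. *)
Lemma mgronwall m n (D dD : K -> 'M[K]_(m, n)) :
  mcont D -> D 0 = 0 -> (forall t : K, 0 < t -> mder D t (dD t)) ->
  (forall T : K, exists2 L, 0 <= L & forall t, 0 < t < T -> `|dD t| <= L * `|D t|) ->
  forall t, 0 <= t -> D t = 0.
Proof.
move=> cD D0 hD hL T; rewrite le_eqVlt => /predU1P[<-//|T0].
(* The squared Frobenius norm is differentiable, unlike the maximum norm. *)
pose g t : K := \sum_i \sum_j D t i j * D t i j.
pose dg t : K := \sum_i \sum_j (dD t i j * D t i j + D t i j * dD t i j).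
have D_le t : `|D t| ^+ 2 <= g t.
  have g0 : 0 <= g t.
    by apply: sumr_ge0 => i _; apply: sumr_ge0 => j _; rewrite -expr2 sqr_ge0.
  rewrite -(sqr_sqrtr g0) ler_sqr ?nnegrE ?sqrtr_ge0//.
  apply: mx_norm_le => [|i j]; first exact: sqrtr_ge0.
  rewrite -ler_sqr ?nnegrE ?sqrtr_ge0// sqr_sqrtr// real_normK ?num_real//.
  rewrite /g (bigD1 i)//= (bigD1 j)//= -expr2 -addrA lerDl addr_ge0//.
    by apply: sumr_ge0 => k _; rewrite -expr2 sqr_ge0.
  by apply: sumr_ge0 => k _; apply: sumr_ge0 => l _; rewrite -expr2 sqr_ge0.
have [L L0 hLT] := hL T.
have cg : {within `[0, T], continuous g}.
  have sub : `[0, T] `<=` `[0 : K, +oo[.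
    by move=> t /=; rewrite !in_itv/= andbT => /andP[].
  apply: (continuous_subspaceW sub) => x.
  apply: cvg_sumr => i; apply: cvg_sumr => j.
  by apply: cvgM; exact: cD.
have hdg t : 0 < t < T -> is_derive t 1 g (dg t).
  move=> /andP[t0 _]; apply: is_derive_sumr => i; apply: is_derive_sumr => j.
  by apply: is_derive_mul; exact: hD.
have := @gronwall _ g dg (\sum_(i < m) \sum_(j < n) (2 * L)) T T0 cg hdg.
have -> : g 0 = 0.
  by rewrite /g D0 big1// => i _; rewrite big1// => j _; rewrite mxE mul0r.
rewrite mulr0 => hgT; apply/eqP; rewrite -normr_eq0 -sqrf_eq0 eq_le sqr_ge0 andbT.
apply: le_trans (D_le T) (hgT _) => t tT.
rewrite mulr_suml ler_sum// => i _; rewrite mulr_suml ler_sum// => j _.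
rewrite mulrC -mulrDl -mulr2n -[_ *+ 2]mulr_natl -mulrA -mulrA ler_pM2l//.
rewrite (le_trans (ler_norm _))// normrM.
rewrite (@le_trans _ _ ((L * `|D t|) * `|D t|))//.
  by rewrite mulrC ler_pM// ?mx_norm_entry// (le_trans (mx_norm_entry _ _ _))// hLT.
by rewrite -mulrA -expr2 ler_wpM2l.
Qed.

Definition loclip m n p q (F : 'M[K]_(m, n) -> 'M[K]_(p, q)) :=
  forall b, exists2 L, 0 <= L & forall X Y, `|X| <= b -> `|Y| <= b ->
    `|F X - F Y| <= L * `|X - Y|.

Lemma loclip_cst m n p q (M : 'M[K]_(p, q)) : loclip (fun _ : 'M[K]_(m, n) => M).
Proof. by move=> b; exists 0 => // X Y _ _; rewrite subrr normr0 mul0r. Qed.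

Lemma loclip_id m n : loclip (fun X : 'M[K]_(m, n) => X).
Proof. by move=> b; exists 1 => // X Y _ _; rewrite mul1r. Qed.

Lemma loclipD m n p q (F G : 'M[K]_(m, n) -> 'M[K]_(p, q)) :
  loclip F -> loclip G -> loclip (fun X => F X + G X).
Proof.
move=> hF hG b; have [L L0 hL] := hF b; have [M M0 hM] := hG b.
exists (L + M) => [|X Y hX hY]; first exact: addr_ge0.
by rewrite opprD addrACA mulrDl (le_trans (ler_normD _ _))// lerD ?hL ?hM.
Qed.

Lemma loclipN m n p q (F : 'M[K]_(m, n) -> 'M[K]_(p, q)) :
  loclip F -> loclip (fun X => - F X).
Proof.
move=> hF b; have [L L0 hL] := hF b; exists L => // X Y hX hY.
by rewrite -opprD normrN hL.
Qed.

Lemma linear_bound m n p q (L : {linear 'M[K]_(m, n) -> 'M[K]_(p, q)}) :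
  exists2 k, 0 <= k & forall X, `|L X| <= k * `|X|.
Proof.
pose c i j := \sum_k \sum_l `|L (delta_mx k l) i j|.
have c0 i j : 0 <= c i j by apply: sumr_ge0 => k _; exact: sumr_ge0.
have s0 : 0 <= \sum_i \sum_j c i j.
  by apply: sumr_ge0 => k _; exact: sumr_ge0.
exists (\sum_i \sum_j c i j) => // X.
apply: mx_norm_le => [|i j]; first exact: mulr_ge0.
rewrite (@le_trans _ _ (c i j * `|X|))//; last first.
  rewrite ler_wpM2r// (bigD1 i)//= (bigD1 j)//= -addrA lerDl addr_ge0//.
    by apply: sumr_ge0 => l _.
  by apply: sumr_ge0 => k _; exact: sumr_ge0.
rewrite linear_entry mulr_suml (le_trans (ler_norm_sum _ _ _))// ler_sum// => k _.
rewrite mulr_suml (le_trans (ler_norm_sum _ _ _))// ler_sum// => l _.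
by rewrite normrM mulrC ler_wpM2l// mx_norm_entry.
Qed.

Lemma loclip_linear m n p q u v (L : {linear 'M[K]_(p, q) -> 'M[K]_(u, v)})
  (F : 'M[K]_(m, n) -> 'M[K]_(p, q)) : loclip F -> loclip (fun X => L (F X)).
Proof.
move=> hF b; have [M M0 hM] := hF b; have [k k0 hk] := linear_bound L.
exists (k * M) => [|X Y hX hY]; first exact: mulr_ge0.
by rewrite -linearB (le_trans (hk _))// -mulrA ler_wpM2l// hM.
Qed.

Lemma mx_normM m n p (A : 'M[K]_(m, n)) (B : 'M[K]_(n, p)) :
  `|A *m B| <= n%:R * `|A| * `|B|.
Proof.
apply: mx_norm_le => [|i j]; first by rewrite !mulr_ge0.
rewrite mxE (le_trans (ler_norm_sum _ _ _))//.
rewrite (@le_trans _ _ (\sum_(k < n) `|A| * `|B|))//.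
  by rewrite ler_sum// => k _; rewrite normrM ler_pM// mx_norm_entry.
by rewrite sumr_const card_ord -[leLHS]mulr_natl mulrA.
Qed.

Lemma loclip_bound m n p q (F : 'M[K]_(m, n) -> 'M[K]_(p, q)) b : loclip F ->
  exists2 c, 0 <= c & forall X, `|X| <= b -> `|F X| <= c.
Proof.
move=> hF; have [b0|b0] := ltP b 0.
  by exists 0 => // X; rewrite leNgt (lt_le_trans b0).
have [L L0 hL] := hF b; exists (L * b + `|F 0|) => [|X hX].
  by rewrite addr_ge0// mulr_ge0.
rewrite -[F X](subrK (F 0)) (le_trans (ler_normD _ _))// lerD//.
by rewrite (le_trans (hL X 0 _ _))// ?normr0// subr0 ler_wpM2l.
Qed.

Lemma loclipM m n p q u (F : 'M[K]_(m, n) -> 'M[K]_(p, q))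
    (G : 'M[K]_(m, n) -> 'M[K]_(q, u)) :
  loclip F -> loclip G -> loclip (fun X => F X *m G X).
Proof.
move=> hF hG b; have [L L0 hL] := hF b; have [M M0 hM] := hG b.
have [c c0 hc] := loclip_bound b hF; have [d d0 hd] := loclip_bound b hG.
exists (q%:R * L * d + q%:R * c * M) => [|X Y hX hY].
  by rewrite addr_ge0// !mulr_ge0.
have -> : F X *m G X - F Y *m G Y = (F X - F Y) *m G X + F Y *m (G X - G Y).
  by rewrite mulmxBl mulmxBr addrA subrK.
rewrite (le_trans (ler_normD _ _))// mulrDl lerD// (le_trans (mx_normM _ _))//.
  by rewrite -!mulrA ler_wpM2l// (mulrC d) mulrA ler_pM ?hL ?hd.
by rewrite -!mulrA ler_wpM2l// ler_pM ?hM ?hc.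
Qed.

(* [f - sigma f] solves a linear differential inequality because
   [F] maps the range of [sigma] into itself. *)
Lemma ode_invariant n (sigma : {linear 'M[K]_n -> 'M[K]_n}) F Q f :
  loclip F -> (forall X, sigma X = X -> sigma (F X) = F X) ->
  (forall X, sigma (sigma X) = sigma X) ->
  ode_solution F Q f -> sigma Q = Q -> forall t, 0 <= t -> sigma (f t) = f t.
Proof.
move=> hF sF sK sol sQ t t0; apply/eqP; rewrite eq_sym -subr_eq0; apply/eqP.
have cf := ode_mcont sol; have [f0 _ _] := sol.
pose D s := f s - sigma (f s); pose dD s := F (f s) - sigma (F (f s)).
apply: (@mgronwall _ _ D dD) t0 => [||s s0|T].
- by apply: mcontB => //; exact: mcont_linear.
- by rewrite /D f0 sQ subrr.
- have := ode_mder sol s0 => hd.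
  by apply: mderB => //; exact: mder_linear.
have [b b0 hb] := mcont_bounded T cf.
have [k k0 hk] := linear_bound sigma.
(* This radius contains both [f] and its image under [sigma] up to time [T]. *)
have [L L0 hL] := hF (Num.max b (k * b)).
exists ((1 + k) * L) => [|s /andP[s0 sT]]; first by rewrite mulr_ge0// addr_ge0.
pose X := F (f s) - F (sigma (f s)).
have hs : `|f s| <= b by rewrite hb// !ltW.
(* [F (sigma (f s))] is fixed by [sigma], so it cancels. *)
have -> : dD s = X - sigma X.
  by rewrite /dD /X [sigma (_ - _)]linearB /= [sigma (F (sigma _))]sF// opprB addrA subrK.
rewrite (le_trans (ler_normB _ _))// -mulrA mulrDl mul1r lerD//; last first.
  rewrite (le_trans (hk _))// ler_wpM2l//.
  rewrite hL// le_max ?hs// orbC (le_trans (hk _)) ?ler_wpM2l//.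
by rewrite hL// le_max ?hs// orbC (le_trans (hk _)) ?ler_wpM2l.
Qed.

(** Stated for curves instead of [ode_solution], so that it applies to the image of a flow under
    [pi]. *)
Lemma ode_unique n (F : 'M[K]_n -> 'M[K]_n) f g : loclip F -> f 0 = g 0 ->
  mcont f -> (forall t : K, 0 < t -> mder f t (F (f t))) ->
  mcont g -> (forall t : K, 0 < t -> mder g t (F (g t))) ->
  forall t, 0 <= t -> f t = g t.
Proof.
move=> hF fg0 cf df cg dg t t0; apply/eqP; rewrite -subr_eq0; apply/eqP.
apply: (@mgronwall _ _ (fun s => f s - g s) (fun s => F (f s) - F (g s))) t0 => [||s s0|T].
- exact: mcontB.
- by rewrite fg0 subrr.
- by apply: mderB; [exact: df|exact: dg].
have [b b0 hb] := mcont_bounded T cf; have [c c0 hc] := mcont_bounded T cg.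
have [L L0 hL] := hF (Num.max b c).
exists L => // s /andP[s0 sT].
by rewrite hL// le_max ?hb ?hc ?orbT// !ltW.
Qed.

End MatrixODE.

(** * Barrier principle for symmetric matrix curves *)

Section Barrier.
Context {K : realType}.

(** Freezing the function at its value at 0 on negative times extends it continuously to the whole
    line. *)
Lemma continuous_max0 (g : K -> K) :
  {within `[0, +oo[, continuous g} -> continuous (fun s : K => g (Num.max s 0)).
Proof.
move=> /subspace_continuousP cg s.
have s0 : `[0, +oo[%classic (Num.max s 0) by rewrite /= in_itv/= andbT le_max lexx orbT.
apply: (@cvg_comp _ _ _ (fun s : K => Num.max s 0) g _
  (within `[0, +oo[ (nbhs (Num.max s 0)))); last exact: cg.
move=> A; rewrite /within /= => wA.
have cm : (fun x : K => Num.max x 0) x @[x --> s] --> Num.max s 0.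
  by apply: (@continuous_max _ _ id (cst 0)); [exact: cvg_id|exact: cvg_cst].
have : \forall x \near nbhs s, [set y | `[0, +oo[%classic y -> A y] (Num.max x 0) := cm _ wA.
apply: filterS => x /=; apply.
by rewrite /= in_itv/= andbT le_max lexx orbT.
Qed.

Lemma is_derive_left_le0 (q : K -> K) (t dq : K) : 0 < t ->
  is_derive t 1 q dq -> (forall s, 0 <= s < t -> 0 <= q s) -> q t = 0 -> dq <= 0.
Proof.
move=> t0 [dqt <-] hq qt; rewrite leNgt; apply/negP => d0.
move: dqt => /cvg_ex[/= l hl]; have dl : 'D_1 q t = l by exact/cvg_lim.
rewrite dl in d0; move/cvgrPdist_lt : hl => /(_ _ d0)[/= e e0 he].
(* A negative increment of size at most t, so that t + h stays nonnegative. *)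
pose h := - (Num.min (e / 2) t).
have m0 : 0 < Num.min (e / 2) t by rewrite lt_min divr_gt0.
have hn0 : h < 0 by rewrite oppr_lt0.
have h1 : `|h| < e.
  by rewrite normrN gtr0_norm// gt_min ltr_pdivrMr// ltr_pMr// ltr1n.
have := he h; rewrite /ball_ /= sub0r normrN => /(_ h1 (ltr0_neq0 hn0)).
apply/negP; rewrite -leNgt qt subr0.
rewrite (le_trans _ (ler_norm _))// lerDl oppr_ge0 /GRing.scale /=.
apply: mulr_le0_ge0; first by rewrite invr_le0 ltW.
by apply: hq; rewrite mulr1 addrC subr_ge0 ge_min lexx orbT/= ltrBlDr ltrDl.
Qed.

Lemma is_derive_left_ge0 (q : K -> K) (t dq : K) : 0 < t ->
  is_derive t 1 q dq -> (forall s, 0 <= s < t -> 0 <= q s) -> 0 <= q t.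
Proof.
move=> t0 [dqt _] hq; rewrite leNgt; apply/negP => q0.
have cq : {for t, continuous q}.
  by apply: differentiable_continuous; exact/derivable1_diffP.
have : \forall s \near nbhs t, q s < 0 by exact: cvgr_lt cq _ q0.
move=> /nbhs_ballP[e /= e0 he].
have m0 : 0 < Num.min (e / 2) t by rewrite lt_min divr_gt0.
have /he : ball t e (t - Num.min (e / 2) t).
  rewrite /ball /= opprB addrC subrK gtr0_norm//.
  by rewrite gt_min ltr_pdivrMr// ltr_pMr// ltr1n.
rewrite ltNge hq// subr_ge0 ge_min lexx orbT/= ltrBlDr ltrDl//.
Qed.

(** First-contact argument. The pairs (s, v) with s in [0, T], v a unit vector and v'F(s)v <= 0 form
    a compact set. If it is not empty, it has a least time tau, positive since F(0) > 0. By
    continuity F(tau) is semidefinite, and v lies in its kernel. As v'F v is nonnegative before tau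
    and zero at tau, its derivative there is nonpositive, against the hypothesis. *)
Lemma barrier n (F dF : K -> 'M[K]_n) : mcont F ->
  (forall t : K, 0 <= t -> (F t)^T = F t) ->
  (forall t : K, 0 < t -> mder F t (dF t)) -> posdef (F 0) ->
  (forall (t : K) x, 0 < t -> x != 0 -> psd (F t) -> F t *m x = 0 ->
     0 < dot x (dF t *m x)) ->
  forall t, 0 <= t -> psd (F t).
Proof.
move=> cF sF hF /posdef_dot[_ F0] pF T T0.
apply/psd_dot; split => [|x]; first exact: sF.
rewrite leNgt; apply/negP => xT.
have x0 : x != 0 by apply: contraTneq xT => ->; rewrite dot0l ltxx.
have cFe i j : continuous (fun s : K => (F (Num.max s 0)) i j).
  exact: (continuous_max0 (cF i j)).
have cq := quad_continuous cFe.
set q := (fun p : K * 'rV[K]_n => _) in cq.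
pose G := (`[0, T] `*` @sphere K n) `&` [set p | q p <= 0].
have cG : compact G.
  apply: compact_closedI.
    by apply: compact_setX; [exact: segment_compact|exact: compact_sphere].
  by apply: (@closed_comp _ _ q [set y | y <= 0]) => [p _|]; [exact: cq|exact: closed_le].
have cfst : continuous (fst : K * 'rV[K]_n -> K) by move=> p; exact: cvg_fst.
pose nz (y : 'cV[K]_n) := (Num.sqrt (dot y y))^-1 *: y.
have dot_nz y M : dot (nz y) (M *m nz y) = (Num.sqrt (dot y y))^-1 ^+ 2 * dot y (M *m y).
  by rewrite /nz -scalemxAr !dot_lin mulrA -expr2.
(* Normalization turns every nonzero vector with nonpositive form into a point of [G]. *)
have inG s y : 0 <= s <= T -> y != 0 -> dot y (F s *m y) <= 0 -> G (s, (nz y)^T).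
  move=> sT y0 hy; split; [split => /=|].
  - by rewrite in_itv.
  - exact: sphereZ.
  rewrite /q /= trmxK (max_idPl _); last by case/andP: sT.
  by rewrite dot_nz mulr_ge0_le0// sqr_ge0.
have [|[tau v] /=] := compact_EVT_min _ cG (continuous_subspaceT cfst).
  by exists (T, (nz x)^T); apply: inG => //; [rewrite T0 lexx|exact: ltW].
rewrite inE => -[[/= + v1] qv] htau; rewrite in_itv/= => /andP[tau0 tauT].
rewrite /q /= (max_idPl tau0) in qv.
have v0 : v^T != 0.
  by apply/eqP => v0; move: v1; rewrite /sphere /= v0 dot0r => /eqP; rewrite eq_sym oner_eq0.
have tau_gt0 : 0 < tau.
  rewrite lt_def tau0 andbT; apply: contraTneq qv => ->.
  by rewrite -ltNge F0.
have before y s : 0 <= s < tau -> 0 <= dot y (F s *m y).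
  move=> /andP[s0 st]; have sT : s <= T by rewrite (le_trans (ltW st)).
  have [->|y0] := eqVneq y 0; first by rewrite dot0l.
  rewrite leNgt; apply/negP => hy; move: st; rewrite ltNge => /negP; apply.
  have := htau (s, (nz y)^T); rewrite inE; apply; apply: inG => //; last exact: ltW.
  by rewrite s0.
have ptau : psd (F tau).
  apply/psd_dot; split => [|y]; first exact: sF.
  apply: (is_derive_left_ge0 tau_gt0 (is_derive_quad y y (hF _ tau_gt0))) => s.
  exact: before.
have q0 : dot v^T (F tau *m v^T) = 0.
  by apply/eqP; rewrite eq_le qv; move/psd_dot : ptau => [_ ->].
have := pF _ _ tau_gt0 v0 ptau (psd_ker ptau q0); rewrite ltNge => /negP; apply.
apply: (is_derive_left_le0 tau_gt0 (is_derive_quad v^T v^T (hF _ tau_gt0))) => // s.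
exact: before.
Qed.

End Barrier.

(** * The Riccati equation: symmetry, upper bound, exponential comparison *)

Section Riccati.
Context {K : realType} {n : nat}.
Implicit Types (A S R Q X : 'M[K]_n) (f p : K -> 'M[K]_n).

(** The linear projector onto symmetric matrices; symmetry of solutions becomes an instance of
    [ode_invariant]. *)
Definition symmx X : 'M[K]_n := 2^-1 *: (X + X^T).

Fact symmx_is_linear : linear symmx.
Proof.
by move=> c X Y; apply/matrixP => i j; rewrite !mxE; ring.
Qed.

HB.instance Definition _ := GRing.isLinear.Build K 'M[K]_n 'M[K]_n _ symmx
  symmx_is_linear.

Lemma symmxP X : (symmx X = X) <-> (X^T = X).
Proof.
rewrite /symmx; split => [<-|->].
  by rewrite linearZ /= linearD /= trmxK addrC.
by rewrite -mulr2n -[X *+ 2]scaler_nat scalerA mulVf ?scale1r// pnatr_eq0.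
Qed.

Lemma ode_sym (F : 'M[K]_n -> 'M[K]_n) Q f :
  loclip F -> (forall X, X^T = X -> (F X)^T = F X) ->
  ode_solution F Q f -> Q^T = Q -> forall t, 0 <= t -> (f t)^T = f t.
Proof.
move=> lF sF sol /symmxP sQ t t0; apply/symmxP.
apply: (ode_invariant lF _ _ sol sQ t0) => X.
  by move=> /symmxP/sF/symmxP.
by apply/symmxP; rewrite /symmx linearZ /= linearD /= trmxK addrC.
Qed.

Lemma Ricc_loclip A S R : loclip (Ricc A S R).
Proof.
apply: loclipD; last exact: loclip_cst.
apply: loclipD; last first.
  apply/loclipN/loclipM; last exact: loclip_id.
  by apply: loclipM; [exact: loclip_id|exact: loclip_cst].
by apply: loclipD; apply: loclipM; (exact: loclip_id || exact: loclip_cst).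
Qed.

Lemma Ricc_sym A S R X : S^T = S -> R^T = R -> X^T = X ->
  (Ricc A S R X)^T = Ricc A S R X.
Proof.
move=> sS sR sX; rewrite /Ricc !linearD /= linearN /= !trmx_mul sS sR sX trmxK.
by rewrite mulmxA [X *m A^T + _]addrC.
Qed.

Lemma Ricc_quad A S R X x : X^T = X ->
  dot x (Ricc A S R X *m x) = 2 * dot x (A *m (X *m x))
    - dot (X *m x) (S *m (X *m x)) + dot x (R *m x).
Proof.
move=> sX; rewrite /Ricc !mulmxDl mulNmx -!mulmxA !dot_lin.
rewrite [dot x (X *m (A^T *m x))]dot_mulmxr sX [dot _ (A^T *m x)]dot_mulmxr trmxK.
by rewrite [dot (A *m _) x]dotC [dot x (X *m (S *m _))]dot_mulmxr sX; lra.
Qed.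

Section Flow.
Variables (A S R : 'M[K]_n).
Hypotheses (sS : S^T = S) (pR : posdef R).

Let sR : R^T = R. Proof. by case/posdef_dot: pR. Qed.

Lemma riccati_sym Q p : ode_solution (Ricc A S R) Q p -> Q^T = Q ->
  forall t, 0 <= t -> (p t)^T = p t.
Proof.
move=> sol sQ; apply: ode_sym sol sQ; first exact: Ricc_loclip.
by move=> X; exact: Ricc_sym.
Qed.

(* The supersolution is [h(t) W^-1] with [h(t) = k + M exp(-rho t)]. *)
Lemma riccati_upper lam W : psd S -> 0 < lam -> posdef W ->
  A^T *m W + W *m A = S - lam *: W ->
  exists M0 y, [/\ 0 < M0, 0 <= y & forall rho d Q p, 0 < rho -> rho <= lam ->
    ode_solution (Ricc A S R) Q p -> psd Q -> 0 <= d ->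
    (forall x, dot x (Q *m x) <= d * dot x x) ->
    forall t x, 0 <= t ->
      dot x (p t *m x) <= (M0 + y * d * expR (- rho * t)) * dot x x].
Proof.
move=> /psd_dot[_ pS] lam0 pW WE; pose Y := invmx W.
have uW := posdef_unit pW; have [y0 y00 hy0] := posdef_lb (posdef_inv pW).
have [y1 y10 hy1] := dot_bound Y; have [rb rb0 hrb] := dot_bound R.
have [sY _] := (posdef_dot Y).1 (posdef_inv pW).
have [sW _] := (posdef_dot W).1 pW.
(* Chosen so that lam k y0 exceeds the bound rb of [R]; k >= 1 ensures h >= 1. *)
pose k := 1 + (rb + 1) / (lam * y0).
have ly0 : 0 < lam * y0 by rewrite mulr_gt0.
have k1 : 1 <= k by rewrite lerDl divr_ge0// ?ltW//; lra.
have kE : k * (lam * y0) = lam * y0 + rb + 1.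
  by rewrite mulrDl mul1r divfK ?gt_eqF// addrA.
exists ((y1 + 1) * k), (y1 / y0); split => [||rho d Q p rho0 rhol sol pQ d0 hd t x t0].
- by rewrite mulr_gt0//; lra.
- by rewrite divr_ge0// ltW.
(* As Y >= y0, the matrix M Y dominates d, hence Q, at time 0. *)
pose M := d / y0; have M0 : 0 <= M by rewrite divr_ge0// ltW.
have ME : M * y0 = d by rewrite divfK// gt_eqF.
pose h u := k + M * expR (- rho * u).
have hge1 u : 1 <= h u by rewrite /h (le_trans k1)// lerDl mulr_ge0// expR_ge0.
pose dh u := - rho * M * expR (- rho * u).
have hdh (u : K) : is_derive u 1 h (dh u).
  rewrite /dh mulrAC; rewrite (_ : h = cst k + (fun u => expR (- rho * u) * M)).
    rewrite -[X in is_derive _ _ _ X]add0r.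
    have := is_derive_mulr M (is_derive_expRM (- rho) u) => ?.
    exact: is_deriveD.
  by apply/funext => v; rewrite /h (mulrC M).
have /psd_dot[sQ _] := pQ; have sp := riccati_sym sol sQ.
pose F u := h u *: Y - p u.
have cF : mcont F.
  apply: mcontB; last exact: ode_mcont sol.
  apply: mcontZ; last exact: mcont_cst.
  apply: continuous_subspaceT => u; apply: differentiable_continuous.
  by apply/derivable1_diffP; have [] := hdh u.
have hF u : 0 < u -> mder F u (h u *: 0 + dh u *: Y - Ricc A S R (p u)).
  move=> u0; apply: mderB; last exact: ode_mder sol u0.
  by apply: mderZ; exact: mder_cst.
have quadF u z : dot z (F u *m z) = h u * dot z (Y *m z) - dot z (p u *m z).
  by rewrite mulmxBl -scalemxAl !dot_lin.
have /psd_dot[_ /(_ x)] : psd (F t).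
  apply: (barrier cF _ hF) t0 => [u u0||u z u0 z0 pF Fz].
  - by rewrite linearB linearZ /= sY sp.
  - case: sol => p0 _ _; apply/posdef_dot; split => [|z z0].
      by rewrite linearB linearZ /= sY sp.
    have hE : h 0 = k + M by rewrite /h mulr0 expR0 mulr1.
    rewrite quadF p0 hE; have := hd z; have := hy0 z; have := dot_gt0 z0.
    rewrite -/Y; move: (dot z z) (dot z (Y *m z)) (dot z (Q *m z)) => Z z1 z2 Z0 l1 l2.
    have : (k + M) * (y0 * Z) <= (k + M) * z1.
      by rewrite ler_wpM2l// addr_ge0// (le_trans ler01).
    have : 0 < k * (y0 * Z) by rewrite !mulr_gt0//; lra.
    have : M * (y0 * Z) = d * Z by rewrite mulrA ME.
    lra.
  (* At a kernel vector z one has p z = h v, and the Lyapunov equation reads 2 z'A v = v'S v - lam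
     z'v. The derivative of the form is then (h' + lam h) z'v + (h^2 - h) v'S v - z'R z, whose
     middle term is nonnegative as h >= 1. *)
  pose v := Y *m z.
  have pz : p u *m z = h u *: v.
    by apply/esym/eqP; rewrite -subr_eq0 scalemxAl -mulmxBl Fz.
  have zW : z = W *m v by rewrite /v mulmxA mulmxV// mul1mx.
  have lyap : 2 * dot z (A *m v) = dot v (S *m v) - lam * dot z v.
    have : dot v ((A^T *m W + W *m A) *m v) = dot v ((S - lam *: W) *m v).
      by rewrite WE.
    rewrite mulmxDl mulmxBl -scalemxAl -!mulmxA -zW !dot_lin (dotC z v).
    by rewrite [dot v (A^T *m z)]dot_mulmxr trmxK [dot v (W *m _)]dot_mulmxr sW -zW
      (dotC (A *m v)); lra.
  rewrite scaler0 add0r mulmxBl -scalemxAl !dot_lin -/v Ricc_quad ?sp ?(ltW u0)// pz.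
  rewrite -!scalemxAr !dot_lin.
  have -> : 2 * (h u * dot z (A *m v)) = h u * (dot v (S *m v) - lam * dot z v).
    by rewrite -lyap; ring.
  have := pS v; have := hrb z; rewrite ler_norml => /andP[_]; have := hy0 z; rewrite -/Y -/v.
  have := dot_gt0 z0; have := hge1 u.
  move: (dot z z) (dot z v) (dot v (S *m v)) (dot z (R *m z)) => Z zv vs zr h1 Z0 l1 l2 l3.
  (* Here rho <= lam enters: the decaying part of [h] contributes (lam - rho) M exp(- rho u) >=
     0. *)
  have e1 : lam * k <= dh u + lam * h u.
    have : 0 <= (lam - rho) * (M * expR (- rho * u)).
      by apply: mulr_ge0; [rewrite subr_ge0|rewrite mulr_ge0 ?expR_ge0].
    rewrite /dh /h; lra.
  have e2 : (lam * k) * (y0 * Z) <= (dh u + lam * h u) * zv.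
    by rewrite ler_pM ?mulr_ge0//; lra.
  have e3 : 0 <= (h u * h u - h u) * vs.
    by rewrite mulr_ge0// subr_ge0 ler_peMr// (le_trans ler01).
  have e4 : (lam * k) * (y0 * Z) = (lam * y0 + rb + 1) * Z by rewrite -kE; ring.
  have e5 : 0 < (lam * y0) * Z by rewrite mulr_gt0.
  lra.
rewrite quadF subr_ge0 => /le_trans; apply.
have hy : dot x (Y *m x) <= y1 * dot x x by rewrite (le_trans (ler_norm _)).
rewrite (@le_trans _ _ (h t * (y1 * dot x x)))//.
  by rewrite ler_wpM2l// (le_trans ler01).
rewrite mulrA ler_wpM2r ?dot_ge0// /h mulrDl lerD//.
  by rewrite mulrC ler_wpM2r//; lra.
by rewrite le_eqVlt; apply/orP; left; apply/eqP; rewrite /M; ring.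
Qed.

End Flow.

(** Since p' = (A - p S) p + p (A - p S)' + p S p + R, the curve p is a strict supersolution of the
    linear equation of [D]. The positivity of [R] leaves room for the shift eta and for a growing
    factor u in front of [D], so that u D <= g (p + eta) persists. The semidefinite term [N] covers
    both a linear equation and one with the quadratic term D S D. *)
Lemma riccati_decay A S R p D N r a s eta rho M0 M d Q :
  psd S -> posdef R -> ode_solution (Ricc A S R) Q p -> psd Q ->
  (forall x, r * dot x x <= dot x (R *m x)) ->
  (forall x, dot x (A *m x) <= a * dot x x) ->
  (forall x, dot x (S *m x) <= s * dot x x) ->
  0 < eta -> 0 < rho -> 0 < M0 -> 0 <= M -> 0 <= d ->
  0 < r - rho * (M0 + eta) - 2 * eta * a - eta ^+ 2 * s ->
  (forall t x, 0 <= t -> dot x (p t *m x) <= (M0 + M * expR (- rho * t)) * dot x x) ->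
  mcont D -> (forall t, 0 <= t -> (D t)^T = D t) ->
  (forall t : K, 0 < t -> mder D t
     ((A - p t *m S) *m D t + D t *m (A - p t *m S)^T - N t)) ->
  (forall t x, 0 < t -> 0 <= dot x (N t *m x)) ->
  (forall x, dot x (D 0 *m x) <= d * dot x x) ->
  forall t x, 0 <= t ->
    dot x (D t *m x) <= (M0 + M) / eta * (1 + eta / M0) * d * expR (- rho * t) * dot x x.
Proof.
move=> pS pR sol pQ hr ha hs eta0 rho0 M00 M_ge0 d0 hc hp cD sD hD hN hd t x t0.
have [sS {}pS] := (psd_dot S).1 pS; have [sQ _] := (psd_dot Q).1 pQ.
have sp := riccati_sym sS pR sol sQ.
pose E u := expR (rho * u); pose u_ v := M0 * E v + M.
have E0 v : 0 < E v by exact: expR_gt0.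
have u0 v : 0 < u_ v by rewrite ltr_wpDr// mulr_gt0.
have hp' v y : 0 <= v -> E v * dot y (p v *m y) <= u_ v * dot y y.
  move=> v0; have := hp v y v0; rewrite -(ler_pM2l (E0 v)) => /le_trans; apply.
  rewrite mulrA mulrDr mulNr expRN mulrCA divff ?gt_eqF ?E0// mulr1 (mulrC (E v)).
  by [].
have hu (v : K) : is_derive v 1 u_ (rho * M0 * E v).
  rewrite (_ : u_ = (fun s => E s * M0) + cst M); last first.
    by apply/funext => w; rewrite /u_ mulrC.
  rewrite -[X in is_derive _ _ _ X]addr0 mulrAC.
  have := is_derive_mulr M0 (is_derive_expRM rho v) => ?; exact: is_deriveD.
(* The barrier needs a strict inequality at time 0; the limiting value of g is recovered by letting
   the excess e / (c + 1) tend to 0. *)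
suff H g : (M0 + M) * d < g * eta ->
    E t * dot x (D t *m x) <= g * (1 + eta / M0) * dot x x.
  rewrite mulNr expRN -/(E t) -(ler_pM2l (E0 t)).
  rewrite [leRHS](_ : _ = (M0 + M) * d / eta * ((1 + eta / M0) * dot x x)); last first.
    by field; rewrite !gt_eqF.
  set c := (1 + eta / M0) * dot x x.
  have c0 : 0 <= c by rewrite mulr_ge0 ?dot_ge0// addr_ge0// divr_ge0// ltW.
  apply/ler_addgt0Pr => e e0.
  have := H ((M0 + M) * d / eta + e / (c + 1)); rewrite [(_ + e / _) * eta]mulrDl divfK ?gt_eqF//.
  have c1 : 0 < c + 1 by rewrite ltr_wpDl.
  rewrite ltrDl mulr_gt0 ?divr_gt0// => /(_ isT)/le_trans; apply.
  rewrite -[leLHS]mulrA -/c [leLHS]mulrDl lerD2l -mulrA ler_piMr ?ltW//.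
  by rewrite mulrC ltr_pdivrMr// mul1r ltrDl.
move=> hg; have g0 : 0 < g.
  rewrite -(pmulr_lgt0 _ eta0) (le_lt_trans _ hg)// mulr_ge0// addr_ge0//.
  exact: ltW.
pose F v := g *: (p v + eta%:M) - u_ v *: D v.
have cF : mcont F.
  apply: mcontB.
    apply: mcontZ; first by move=> z; exact: cvg_cst.
    by apply: mcontD; [exact: ode_mcont sol|exact: mcont_cst].
  apply: mcontZ => //.
  apply: continuous_subspaceT => v; apply: differentiable_continuous.
  by apply/derivable1_diffP; have [] := hu v.
pose dF v := g *: (Ricc A S R (p v) + 0) + 0 *: (p v + eta%:M) -
   (u_ v *: ((A - p v *m S) *m D v + D v *m (A - p v *m S)^T - N v) +
    (rho * M0 * E v) *: D v).
have hF v : 0 < v -> mder F v (dF v).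
  move=> v0; apply: mderB; last by apply: mderZ; exact: hD.
  apply: (@mderZ _ _ _ (cst g) (fun v => p v + eta%:M)).
  apply: mderD; last exact: mder_cst.
  exact: ode_mder sol v0.
have quadF v y : dot y (F v *m y) =
    g * (dot y (p v *m y) + eta * dot y y) - u_ v * dot y (D v *m y).
  by rewrite mulmxBl -!scalemxAl mulmxDl mul_scalar_mx !dot_lin.
have /psd_dot[_ /(_ x)] : psd (F t).
  apply: (barrier cF _ hF) t0 => [v v0||v y v0 y0 pF Fy].
  - by rewrite linearB !linearZ /= linearD /= tr_scalar_mx sp ?sD// scalerN.
  - have [p0 _ _] := sol; apply/posdef_dot; split => [|y y0].
      by rewrite linearB !linearZ /= linearD /= tr_scalar_mx sp ?sD// scalerN.
    rewrite quadF p0; have [_ /(_ y) pQy] := (psd_dot Q).1 pQ.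
    rewrite /u_ /E mulr0 expR0 mulr1; have := dot_gt0 y0; have := hd y.
    move: pQy; move: (dot y y) (dot y (Q *m y)) (dot y (D 0 *m y)) => Y q D0 q0 l1 Y0.
    have : (M0 + M) * D0 <= (M0 + M) * (d * Y).
      by rewrite ler_wpM2l// addr_ge0// ltW.
    have : 0 <= g * q by rewrite mulr_ge0// ltW.
    have : (M0 + M) * d * Y < g * eta * Y by rewrite ltr_pM2r.
    lra.
  pose z := p v *m y; pose w := D v *m y.
  (* On the kernel of F this expresses D y through p y and y, and eliminates [D] from the
     derivative. *)
  have uw : u_ v *: w = g *: (z + eta *: y).
    apply/eqP; rewrite eq_sym -subr_eq0; apply/eqP; rewrite -[RHS]Fy.
    by rewrite mulmxBl -!scalemxAl mulmxDl mul_scalar_mx.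
  have sDv := sD v (ltW v0); have spv := sp v (ltW v0).
  have -> : dot y (dF v *m y) = g * dot y (Ricc A S R (p v) *m y)
      - u_ v * (2 * (dot y (A *m w) - dot z (S *m w)) - dot y (N v *m y))
      - rho * M0 * E v * dot y w.
    have quadB B : dot y ((B *m D v + D v *m B^T - N v) *m y) =
        2 * dot y (B *m w) - dot y (N v *m y).
      rewrite mulmxBl mulmxDl !dot_lin -!mulmxA [dot y (D v *m _)]dot_mulmxr sDv -/w.
      by rewrite [dot w (_^T *m _)]dot_mulmxr trmxK [dot (_ *m w) y]dotC; ring.
    have quadw : dot y ((A - p v *m S) *m w) = dot y (A *m w) - dot z (S *m w).
      by rewrite mulmxBl !dot_lin -mulmxA [dot y (p v *m _)]dot_mulmxr spv.
    rewrite -quadw -quadB /dF scale0r !addr0; move: (_ + _ - N v) => G.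
    by rewrite mulmxBl mulmxDl -!scalemxAl !dot_lin -/w; ring.
  rewrite Ricc_quad// -/z.
  have e1 : u_ v * dot y (A *m w) = g * (dot y (A *m z) + eta * dot y (A *m y)).
    by rewrite -dotZr scalemxAr uw -scalemxAr mulmxDr -scalemxAr !dot_lin.
  have e2 : u_ v * dot z (S *m w) = g * (dot z (S *m z) + eta * dot z (S *m y)).
    by rewrite -dotZr scalemxAr uw -scalemxAr mulmxDr -scalemxAr !dot_lin.
  have e3 : u_ v * dot y w = g * (dot y z + eta * dot y y).
    by rewrite -dotZr uw !dot_lin.
  have e4 : E v * dot y z <= u_ v * dot y y by exact: hp' (ltW v0).
  have e5 : 0 <= u_ v * dot y (N v *m y) by rewrite mulr_ge0 ?hN// ltW.
  have e6 : M0 * E v <= u_ v by rewrite lerDl.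
  have Y0 := dot_gt0 y0.
  (* The cost of the growing factor [u_], bounded by means of E p <= u and M0 E <= u. *)
  have e7 : rho * M0 * E v * dot y w <= g * rho * (M0 + eta) * dot y y.
    rewrite -(ler_pM2l (u0 v)) mulrCA e3.
    have -> : rho * M0 * E v * (g * (dot y z + eta * dot y y)) =
      g * rho * (M0 * (E v * dot y z) + (M0 * E v) * (eta * dot y y)) by ring.
    have -> : u_ v * (g * rho * (M0 + eta) * dot y y) =
      g * rho * (M0 * (u_ v * dot y y) + u_ v * (eta * dot y y)) by ring.
    have gr0 : 0 <= g * rho by rewrite mulr_ge0// ltW.
    rewrite ler_wpM2l// lerD//.
      by rewrite ler_wpM2l// ltW.
    by rewrite ler_wpM2r// mulr_ge0 ?ltW.
  (* Completing the square absorbs all terms in z up to - eta^2 y'S y; the remainder is positive by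
     the smallness condition on eta and rho. *)
  have := pS (z + eta *: y).
  rewrite mulmxDr -scalemxAr !dot_lin (dot_sym y z sS).
  have := hr y; have := ha y; have := hs y; move: e1 e2 e5 e7 Y0.
  move: (dot y y) (dot y (A *m w)) (dot z (S *m w)) (dot y (N v *m y)) (dot y w)
    (dot z (S *m z)) (dot z (S *m y)) (dot y (S *m y)) (dot y (A *m z))
    (dot y (A *m y)) (dot y (R *m y)).
  move=> Y yAw zSw yNy yw zSz zSy ySy yAz yAy yRy e1 e2 e5 e7 Y0 l1 l2 l3 l4.
  have m1 : eta * eta * ySy <= eta * eta * (s * Y).
    by rewrite ler_wpM2l// mulr_ge0 ?ltW.
  have m2 : eta * yAy <= eta * (a * Y) by rewrite ler_wpM2l// ltW.
  have m3 : 0 < (r - rho * (M0 + eta) - 2 * eta * a - eta ^+ 2 * s) * Y.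
    by rewrite mulr_gt0.
  have m4 : 0 < zSz + 2 * eta * zSy + yRy - rho * (M0 + eta) * Y - 2 * eta * yAy.
    lra.
  have : 0 < g * (zSz + 2 * eta * zSy + yRy - rho * (M0 + eta) * Y - 2 * eta * yAy).
    by rewrite mulr_gt0.
  lra.
(* The bounds E p <= u and M0 E <= u turn u D <= g (p + eta) into E D <= g (1 + eta / M0). *)
rewrite quadF subr_ge0 => h; rewrite -(ler_pM2l (u0 t)) mulrCA.
have h1 : E t * (u_ t * dot x (D t *m x)) <=
    E t * (g * (dot x (p t *m x) + eta * dot x x)) by rewrite ler_pM2l.
apply: le_trans h1 _.
have -> : E t * (g * (dot x (p t *m x) + eta * dot x x)) =
  g * (E t * dot x (p t *m x) + E t * eta * dot x x) by ring.
have -> : u_ t * (g * (1 + eta / M0) * dot x x) =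
  g * (u_ t * dot x x + u_ t * (eta / M0) * dot x x) by ring.
rewrite ler_wpM2l ?(ltW g0)// lerD ?hp'// ler_wpM2r ?dot_ge0//.
rewrite mulrA ler_pdivlMr// mulrAC ler_wpM2r ?(ltW eta0)//.
by rewrite mulrC lerDl.
Qed.

End Riccati.

(** * Linear Volterra equations *)

Section Volterra.
Context {K : realType}.
Notation mu := (@lebesgue_measure K).

Lemma within_shift (g : K -> K) (a b c : K) : a = b + c ->
  {within `[a, +oo[, continuous g} ->
  {within `[b, +oo[, continuous (fun t => g (t + c))}.
Proof.
move=> abc /subspace_continuousP cg; apply/subspace_continuousP => t /=.
rewrite in_itv/= andbT => bt.
have at_ : `[a, +oo[%classic (t + c) by rewrite /= in_itv/= andbT abc lerD2r.
apply: (@cvg_comp _ _ _ (fun t => t + c) g _ (within `[a, +oo[ (nbhs (t + c))));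
  last exact: cg.
move=> A; rewrite /within /= => wA.
have cs : (fun x : K => x + c) x @[x --> t] --> t + c.
  by apply: cvgD; [exact: cvg_id|exact: cvg_cst].
have : \forall x \near nbhs t, [set y | `[a, +oo[%classic y -> A y] (x + c) := cs _ wA.
apply: filterS => x /= h /[!in_itv]/= /[!andbT] bx; apply: h.
by rewrite in_itv/= andbT abc lerD2r.
Qed.

Lemma within_itvcy_at (g : K -> K) (a t : K) : a < t ->
  {within `[a, +oo[, continuous g} -> {for t, continuous g}.
Proof.
move=> at_ cg; have oI : open `]a, +oo[%classic by exact: interval_open.
have : {within `]a, +oo[, continuous g}.
  apply: continuous_subspaceW cg => x /=.
  by rewrite !in_itv/= !andbT => /ltW.
rewrite continuous_open_subspace// => /(_ t); apply.
by rewrite inE /= in_itv/= andbT.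
Qed.

Lemma within_integrable (h : K -> K) (s t : K) :
  {within `[s, +oo[, continuous h} -> mu.-integrable `[s, t] (EFin \o h).
Proof.
move=> ch; apply: continuous_compact_integrable; first exact: segment_compact.
apply: continuous_subspaceW ch => x /=.
by rewrite !in_itv/= andbT => /andP[].
Qed.

Lemma integral_is_derive (h : K -> K) (s t : K) : s < t ->
  {within `[s, +oo[, continuous h} ->
  is_derive t 1 (fun t => Rintegral mu `[s, t] h) (h t).
Proof.
(* Integrability on [s, t + 1] makes t an interior point. *)
move=> st ch; have tt : t < t + 1 by rewrite ltrDl.
have [dH HE] := continuous_FTC1_closed tt (within_integrable (t + 1) ch) st
  (within_itvcy_at st ch).
exact: (DeriveDef dH (etrans (esym (derive1E _ _)) HE)).
Qed.

Lemma integral_continuous (h : K -> K) (s : K) :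
  {within `[s, +oo[, continuous h} ->
  {within `[s, +oo[, continuous (fun t => Rintegral mu `[s, t] h)}.
Proof.
move=> ch; apply/subspace_continuousP => t /= /[!in_itv]/= /[!andbT].
rewrite le_eqVlt => /predU1P[<-|st]; apply: cvg_within_filter.
  have ss : s < s + 1 by rewrite ltrDl.
  have h0 : Rintegral mu `[s, s] h = 0 by rewrite set_itv1 Rintegral_set1.
  have : Rintegral mu `[s, x] h @[x --> s] --> Rintegral mu `[s, s] h.
    rewrite h0.
    exact: (parameterized_integral_cvg_left ss (within_integrable (s + 1) ch)).
  exact.
apply: differentiable_continuous; apply/derivable1_diffP.
by have [] := integral_is_derive st ch.
Qed.

(** Density of the rationals; absolute values index the nonnegative ones by the whole countable type
    [rat]. *)
Lemma continuous_rat0 (g : K -> K) : {within `[0, +oo[, continuous g} ->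
  (forall q : rat, g `|ratr q| = 0) -> forall t, 0 <= t -> g t = 0.
Proof.
move=> cg g0 t t0; apply/eqP; apply: contraT => gt0.
have cm : g (Num.max x 0) @[x --> t] --> g t.
  by rewrite -[in X in _ --> X](max_idPl t0); exact: continuous_max0.
move/cvgrPdist_lt : cm.
have ngt0 : 0 < `|g t| by rewrite normr_gt0.
move=> /(_ _ ngt0)/nbhs_ballP[e /= e0 he].
have /rat_in_itvoo[q] : t < t + e by rewrite ltrDl.
rewrite in_itv/= => /andP[tq qe].
have q0 : 0 <= ratr q :> K by rewrite (le_trans t0)// ltW.
have /he : ball t e (ratr q : K).
  by rewrite /ball /= distrC gtr0_norm ?subr_gt0// ltrBlDl.
by rewrite /= (max_idPl q0) -(ger0_norm q0) g0 subr0 ltxx.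
Qed.

(** The difference of the solutions equals an integral of itself, so it is differentiable with D' =
    L2 D and D = 0 initially, and [mgronwall] applies. Times are shifted by s to start at 0. *)
Lemma volterra_unique n (s : K) (f1 f2 J1 J2 : K -> 'cV[K]_n) (L1 L2 : K -> 'M[K]_n)
    (x : 'cV[K]_n) :
  mcont (fun t => f1 (t + s)) -> mcont (fun t => f2 (t + s)) ->
  mcont (fun t => L2 (t + s)) -> (forall u, s <= u -> L1 u = L2 u) ->
  (forall t, s <= t -> f1 t = x + vint s t (fun u => L1 u *m f1 u) + J1 t) ->
  (forall t, s <= t -> f2 t = x + vint s t (fun u => L2 u *m f2 u) + J2 t) ->
  (forall q : rat, J1 (`|ratr q| + s) = J2 (`|ratr q| + s)) ->
  forall t, s <= t -> f1 t = f2 t.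
Proof.
move=> c1 c2 cL L12 e1 e2 J12.
have back m p (f : K -> 'M[K]_(m, p)) : mcont (fun t => f (t + s)) ->
    forall i j, {within `[s, +oo[, continuous (fun t => f t i j)}.
  move=> cf i j; have -> : (fun t => f t i j) = fun t => f ((t - s) + s) i j.
    by apply/funext => t; rewrite subrK.
  by apply: (@within_shift (fun t => f (t + s) i j) 0 s (- s)); rewrite ?subrr.
have ch1 := mcontM cL c1; have ch2 := mcontM cL c2.
pose D t := f1 (t + s) - f2 (t + s).
have cD : mcont D by exact: mcontB.
pose h u := L2 u *m (f1 u - f2 u).
have ch : mcont (fun t => h (t + s)) by apply: mcontM.
pose I t : 'cV[K]_n := vint s t h.
have IE t : s <= t ->
    vint s t (fun u => L1 u *m f1 u) - vint s t (fun u => L2 u *m f2 u) = I t.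
  move=> st; apply/matrixP => i j; rewrite !mxE.
  rewrite -RintegralB//; last 2 first.
  - rewrite (_ : _ \o _ = EFin \o (fun u => (L1 u *m f1 u) i 0))//.
    apply/(@eq_integrable _ _ _ mu `[s, t] _ (EFin \o (fun u => (L2 u *m f1 u) i 0))) => //.
      by move=> u; rewrite inE /= in_itv/= => /andP[su _]; rewrite L12.
    by apply: within_integrable; exact: (back _ _ (fun u => L2 u *m f1 u)).
  - by apply: within_integrable; exact: (back _ _ (fun u => L2 u *m f2 u)).
  apply: eq_Rintegral => u; rewrite inE /= in_itv/= => /andP[su _].
  by rewrite /h mulmxBr L12// !mxE.
have cI : mcont (fun t => I (t + s)).
  move=> i j; rewrite (_ : (fun t => _) =
      fun t => Rintegral mu `[s, t + s] (fun u => h u i 0)); last first.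
    by apply/funext => t; rewrite mxE.
  apply: (@within_shift (fun t => Rintegral mu `[s, t] (fun u => h u i 0)) s).
    by rewrite add0r.
  by apply: integral_continuous; exact: back.
(* [J1] and [J2] cancel at rational times only; both sides being continuous, the identity extends to
   all times. *)
have DE t : 0 <= t -> D t = I (t + s).
  move=> t0; apply/eqP; rewrite -subr_eq0; apply/eqP/matrixP => i j; rewrite [RHS]mxE.
  have cDI := mcontB cD cI.
  apply: (continuous_rat0 (cDI i j)) t0 => q.
  have sq : s <= `|ratr q| + s by rewrite lerDr.
  by rewrite /D e1// e2// J12 opprD addrACA subrr addr0 opprD addrACA subrr add0r
    IE// subrr mxE.
have D0 : forall t, 0 <= t -> D t = 0.
  have dD (t : K) : 0 < t -> mder D t (h (t + s)).
    move=> t0 i j.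
    apply: (@near_eq_is_derive _ _ _ (fun t => I (t + s) i j)).
      near=> u; rewrite DE//; apply: ltW.
      by near: u; exact: lt_nbhsr.
    rewrite (_ : (fun t => _) = (fun t => Rintegral mu `[s, t] (fun u => h u i 0)) \o shift s);
      last by apply/funext => u; rewrite mxE.
    have st : s < t + s by rewrite ltrDr.
    have h1 := integral_is_derive st (back _ _ _ ch i 0).
    have := @is_derive1_comp _ _ (shift s) t _ _ h1 (is_derive_shift t 1 s).
    by rewrite (ord1 j) mulr1.
  apply: mgronwall dD _ => //.
    rewrite DE// add0r; apply/matrixP => i j.
    by rewrite !mxE set_itv1 Rintegral_set1.
  move=> T; have [b b0 hb] := mcont_bounded T cL.
  exists (n%:R * b) => [|t /andP[t0 tT]]; first by rewrite mulr_ge0.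
  rewrite (le_trans (mx_normM _ _))// ler_wpM2r// ler_wpM2l//.
  by rewrite hb// !ltW.
move=> t st; have := D0 (t - s); rewrite subr_ge0 /D subrK => /(_ st) /eqP.
by rewrite subr_eq0 => /eqP.
Unshelve. all: by end_near. Qed.

End Volterra.

(** * Almost sure uniqueness of the Ito integral and of the filter *)

Section Filters.
Context {K : realType} {d : measure_display} {Omega : measurableType d}.
Variable P : probability Omega K.

Lemma vnorm2D n (x y : 'cV[K]_n) : vnorm2 (x + y) <= vnorm2 x + vnorm2 y.
Proof.
rewrite vnorm2_le ?addr_ge0 ?vnorm2_ge0// !dot_lin sqrrD !sqr_vnorm2 (dotC y x).
have h : dot x y <= vnorm2 x * vnorm2 y.
  rewrite (le_trans (ler_norm _))// -ler_sqr ?nnegrE ?mulr_ge0 ?vnorm2_ge0//.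
  by rewrite real_normK ?num_real// exprMn !sqr_vnorm2 dot_CS.
by rewrite mulr2n; lra.
Qed.

Lemma vnorm2N n (x : 'cV[K]_n) : vnorm2 (- x) = vnorm2 x.
Proof. by rewrite !vnorm2E !dot_lin opprK. Qed.

Lemma vnorm2_eq0 n (x : 'cV[K]_n) : vnorm2 x <= 0 -> x = 0.
Proof. by rewrite vnorm2_le// expr0n => h; apply/eqP; rewrite -dot_eq0 eq_le h dot_ge0. Qed.

Lemma random_vectorB n (Z1 Z2 : Omega -> 'cV[K]_n) :
  random_vector Z1 -> random_vector Z2 -> random_vector (fun w => Z1 w - Z2 w).
Proof.
move=> h1 h2 i; rewrite (_ : (fun w => _) = (fun w => Z1 w i 0) \- (fun w => Z2 w i 0)).
  exact: measurable_funB.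
by apply/funext => w; rewrite !mxE.
Qed.

Lemma random_vector_sum n N (Z : 'I_N -> Omega -> 'cV[K]_n) :
  (forall k, random_vector (Z k)) -> random_vector (fun w => \sum_k Z k w).
Proof.
move=> h i; rewrite (_ : (fun w => _) = fun w => \sum_k Z k w i 0).
  by apply: measurable_sum => k; exact: h.
by apply/funext => w; rewrite summxE.
Qed.

Lemma random_vectorM m n (G : 'M[K]_(m, n)) (Z : Omega -> 'cV[K]_n) :
  random_vector Z -> random_vector (fun w => G *m Z w).
Proof.
move=> h i; rewrite (_ : (fun w => _) = fun w => \sum_k G i k * Z w k 0).
  by apply: measurable_sum => k; apply: measurable_funM; [exact: measurable_cst|exact: h].
by apply/funext => w; rewrite mxE.
Qed.

Lemma measurable_vnorm2 n (Z : Omega -> 'cV[K]_n) e :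
  random_vector Z -> measurable [set w | e <= vnorm2 (Z w)].
Proof.
move=> h.
have mv : measurable_fun [set: Omega] (fun w => vnorm2 (Z w)).
  rewrite /vnorm2; apply: (@measurableT_comp _ _ _ _ _ _ (@Num.sqrt K)).
    by apply: continuous_measurable_fun; exact: sqrt_continuous.
  by apply: measurable_sum => i; apply: measurable_funX; exact: h.
have := mv measurableT `[e, +oo[%classic (measurable_itv _).
by rewrite setTI; congr measurable; apply/seteqP; split => w /=; rewrite in_itv/= andbT.
Qed.

(** Uniform subdivision. The last bound keeps the nodes in the range where the integrator is known
    to be measurable. *)
Lemma partition_exists (s t delta : K) : s <= t -> 0 < delta ->
  exists N u, partition_mesh s t delta N u /\ forall k, s <= u k.
Proof.
move=> st d0; pose N := (Num.truncn ((t - s) / delta)).+1.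
have N0 : 0 < N%:R :> K by rewrite ltr0n.
pose h := (t - s) / N%:R.
have h0 : 0 <= h by rewrite divr_ge0 ?subr_ge0// ltW.
have hE : h * N%:R = t - s by rewrite divfK ?gt_eqF.
exists N, (fun k => s + k%:R * h); split; last by move=> k; rewrite lerDl mulr_ge0.
split => [||k kN]; first by rewrite mul0r addr0.
  by rewrite mulrC hE addrC subrK.
have -> : s + k.+1%:R * h = s + k%:R * h + h by rewrite -natr1; ring.
split; first by rewrite lerDl.
rewrite addrC addKr ler_pdivrMr// -ler_pdivrMl// mulrC ltW//.
exact: truncnS_gt.
Qed.

(** For a fine partition both integrals are within e / 2 of one and the same Riemann sum, outside
    events of probability at most eta / 2 each. A gap of size e thus has probability at most eta,
    for every eta. *)
Lemma ito_unique m n (G1 G2 : K -> 'M[K]_(m, n)) (Y : K -> Omega -> 'cV[K]_n)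
    (s t : K) (Z1 Z2 : Omega -> 'cV[K]_m) : s <= t ->
  (forall u, s <= u -> random_vector (Y u)) ->
  (forall u, s <= u -> G1 u = G2 u) ->
  ito_integral P G1 Y s t Z1 -> ito_integral P G2 Y s t Z2 ->
  {ae P, forall w, Z1 w = Z2 w}.
Proof.
move=> st mY G12 [m1 h1] [m2 h2].
have mZ := random_vectorB m1 m2.
have null e : 0 < e -> P [set w | e <= vnorm2 (Z1 w - Z2 w)] = 0%E.
  move=> e0; have e20 : 0 < e / 2 by rewrite divr_gt0.
  apply/eqP; rewrite eq_le measure_ge0 andbT; apply/lee_addgt0Pr => eta eta0.
  rewrite add0e; have eta20 : 0 < eta / 2 by rewrite divr_gt0.
  have [d1 d10 {}h1] := h1 _ _ e20 eta20; have [d2 d20 {}h2] := h2 _ _ e20 eta20.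
  have d0 : 0 < Num.min d1 d2 by rewrite lt_min d10.
  have [N [u [[u0 uN hu] su]]] := partition_exists st d0.
  have /h1 {}h1 : partition_mesh s t d1 N u.
    split => // k kN; have [? ?] := hu k kN; split => //.
    by rewrite (le_trans (y := Num.min d1 d2))// ge_min lexx.
  have /h2 {}h2 : partition_mesh s t d2 N u.
    split => // k kN; have [? ?] := hu k kN; split => //.
    by rewrite (le_trans (y := Num.min d1 d2))// ge_min lexx orbT.
  pose R w := \sum_(k < N) G2 (u k) *m (Y (u k.+1) w - Y (u k) w).
  have mR : random_vector R.
    by apply: random_vector_sum => k; apply/random_vectorM/random_vectorB; exact: mY.
  have RE w : \sum_(k < N) G1 (u k) *m (Y (u k.+1) w - Y (u k) w) = R w.
    by apply: eq_bigr => k _; rewrite G12.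
  have {}h1 : (P [set w | (e / 2 <= vnorm2 (Z1 w - R w))%R] <= (eta / 2)%:E)%E.
    apply: le_trans h1; rewrite le_eqVlt; apply/orP; left; apply/eqP; congr (P _).
    by apply/seteqP; split => w /=; rewrite RE.
  have mA := measurable_vnorm2 (e / 2) (random_vectorB m1 mR).
  have mB := measurable_vnorm2 (e / 2) (random_vectorB m2 mR).
  apply: (@le_trans _ _ (P ([set w | e / 2 <= vnorm2 (Z1 w - R w)] `|`
                            [set w | e / 2 <= vnorm2 (Z2 w - R w)]))).
    apply: le_measure; rewrite ?inE; [exact: measurable_vnorm2|exact: measurableU|].
    move=> w /= ew; apply/orP; rewrite -[_ || _]negbK negb_or -!ltNge.
    apply/negP => /andP[l1 l2]; move: ew; apply/negP; rewrite -ltNge.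
    rewrite (_ : Z1 w - Z2 w = (Z1 w - R w) + - (Z2 w - R w)).
      by rewrite (le_lt_trans (vnorm2D _ _))// vnorm2N [ltRHS](splitr e) ltrD.
    by rewrite opprB addrA subrK.
  rewrite (le_trans (measureU2 _ _ _))// [eta in leRHS]splitr EFinD leeD//.
(* Countably many thresholds suffice to exclude every positive gap. *)
have : {ae P, forall w, forall k : nat, vnorm2 (Z1 w - Z2 w) < k.+1%:R^-1}.
  apply: ae_foralln => k.
  exists [set w | k.+1%:R^-1 <= vnorm2 (Z1 w - Z2 w)]; split.
  - exact: measurable_vnorm2.
  - by apply: null; rewrite invr_gt0 ltr0n.
  - by move=> w /= /negP; rewrite -leNgt.
apply: filterS => w hw; apply/eqP; rewrite -subr_eq0; apply/eqP/vnorm2_eq0.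
rewrite leNgt; apply/negP => p0.
have := hw (Num.truncn (vnorm2 (Z1 w - Z2 w))^-1); apply/negP; rewrite -leNgt.
rewrite -[leRHS]invrK lef_pV2 ?posrE ?invr_gt0//.
by rewrite ltW// truncnS_gt.
Qed.

(** The null event must not depend on time: the integrals are compared at countably many times,
    after which [volterra_unique] works path by path. *)
Lemma filter_unique n m (A : 'M[K]_n) (C : 'M[K]_(m, n)) (Sigma : 'M[K]_m)
    (Y : K -> Omega -> 'cV[K]_m) (Gam1 Gam2 : K -> 'M[K]_n) (s : K) (x : 'cV[K]_n)
    (psi1 psi2 : K -> Omega -> 'cV[K]_n) :
  (forall u, s <= u -> random_vector (Y u)) ->
  (forall u, s <= u -> Gam1 u = Gam2 u) -> mcont (fun t => Gam2 (t + s)) ->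
  filter_solution P A C Sigma Y Gam1 s x psi1 ->
  filter_solution P A C Sigma Y Gam2 s x psi2 ->
  {ae P, forall w, forall t, s <= t -> psi1 t w = psi2 t w}.
Proof.
move=> mY G12 cG [[_ c1] [J1 [ito1 e1]]] [[_ c2] [J2 [ito2 e2]]].
(* An enumeration of the rationals; the default 0 only repeats a value. *)
pose q k : rat := odflt 0 (unpickle k).
have J12 : {ae P, forall w, forall k,
    J1 (`|ratr (q k)| + s) w = J2 (`|ratr (q k)| + s) w}.
  apply: ae_foralln => k.
  have sk : s <= `|ratr (q k)| + s by rewrite lerDr.
  apply: (ito_unique sk mY _ (ito1 _ sk) (ito2 _ sk)) => u su.
  by rewrite G12.
have shift_cont (psi : K -> Omega -> 'cV[K]_n) w :
    {within `[s, +oo[, continuous (fun t => psi t w)} -> mcont (fun t => psi (t + s) w).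
  move=> cp i j; apply: (@within_shift _ (fun t => psi t w i j) s).
    by rewrite add0r.
  move=> t; apply: (@continuous_comp _ _ _
    ((fun t => psi t w) : subspace _ -> _) (fun M : 'cV[K]_n => M i j)).
    exact: cp.
  exact: coord_continuous.
have c12 : {ae P, forall w, mcont (fun t => psi1 (t + s) w) /\
    mcont (fun t => psi2 (t + s) w)}.
  by apply: filterS2 c1 c2 => w c1 c2; split; exact: shift_cont.
pose E (psi J : K -> Omega -> 'cV[K]_n) (Gam : K -> 'M[K]_n) w := forall t,
  s <= t -> psi t w = x + vint s t (fun u => A *m psi u w -
    Gam u *m C^T *m invmx Sigma *m C *m psi u w) + J t w.
have {e1 e2}e12 : {ae P, forall w, E psi1 J1 Gam1 w /\ E psi2 J2 Gam2 w}.
  by apply: filterS2 e1 e2 => w; split.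
apply: filterS3 c12 e12 J12 => w [{}c1 {}c2] [{}e1 {}e2] J12 t st.
pose L (Gam : K -> 'M[K]_n) u := A - Gam u *m C^T *m invmx Sigma *m C.
apply: (@volterra_unique _ _ s (psi1^~ w) (psi2^~ w) (J1^~ w) (J2^~ w)
  (L Gam1) (L Gam2) x) => //.
- apply: mcontB; first exact: mcont_cst.
  apply: (mcont_linear (L := mulmxr C)); apply: (mcont_linear (L := mulmxr (invmx Sigma))).
  exact: (mcont_linear (L := mulmxr C^T)).
- by move=> u su; rewrite /L G12.
- move=> u su; rewrite e1//; congr (_ + vint _ _ _ + _).
  by apply/funext => v; rewrite /L mulmxBl.
- move=> u su; rewrite e2//; congr (_ + vint _ _ _ + _).
  by apply/funext => v; rewrite /L mulmxBl.
- by move=> q'; have := J12 (pickle q'); rewrite /q pickleK.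
Qed.

End Filters.

(** * The minimizing projection onto the ring and the two flows *)

Lemma sq_line {K : realType} n (D b : 'M[K]_n) c : D^T = D ->
  (D - c *: b) *m (D - c *: b)^T - D *m D^T =
  c ^+ 2 *: (b *m b^T) - c *: (b *m D + D *m b^T).
Proof.
move=> sD; have -> : (D - c *: b)^T = D - c *: b^T.
  by rewrite -[in RHS]sD; apply/matrixP => i j; rewrite !mxE.
rewrite sD mulmxBl !mulmxBr -!scalemxAl -!scalemxAr.
by apply/matrixP => i j; move: (b *m b^T) (b *m D) (D *m b^T) (D *m D) =>
  ? ? ? ?; rewrite !mxE; ring.
Qed.

Section ConditionalExpectation.
Context {K : realType} {n : nat}.
Variables (B : {pred 'M[K]_n}) (pi : {linear 'M[K]_n -> 'M[K]_n}).
Hypothesis B_ring : matrix_ring B.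
Hypothesis pi_pos : positive_map pi.
Hypothesis pi_idem : forall Q, pi (pi Q) = pi Q.
Hypothesis pi_range : forall M, M \in B <-> exists Q, pi Q = M.
Hypothesis pi_argmin : forall Q : 'M[K]_n,
  loewner_argmin B (fun N => pi ((Q - N) *m (Q - N)^T)) (pi Q).

Lemma condexp_fix X : X \in B <-> pi X = X.
Proof. by split=> [/pi_range[Q <-]//|h]; apply/pi_range; exists X. Qed.

Lemma ring_sub X Y : X \in B -> Y \in B -> X - Y \in B.
Proof. by case: B_ring => -[_ h] _; exact: h. Qed.

Lemma ring_add X Y : X \in B -> Y \in B -> X + Y \in B.
Proof. by move=> /condexp_fix hX /condexp_fix hY; apply/condexp_fix; rewrite linearD hX hY. Qed.

Lemma ring_mul X Y : X \in B -> Y \in B -> X *m Y \in B.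
Proof. by case: B_ring => _; exact. Qed.

(** A symmetric matrix is the difference of the semidefinite matrices X + a and a, for a large. *)
Lemma posmap_sym X : X^T = X -> (pi X)^T = pi X.
Proof.
move=> sX; have [a a0 ha] := dot_bound X.
have h1 : psd (X + a%:M).
  apply/psd_dot; split => [|x]; first by rewrite linearD /= tr_scalar_mx sX.
  rewrite mulmxDl mul_scalar_mx !dot_lin; have := ha x; rewrite ler_norml => /andP[h _].
  by rewrite -lerBlDr sub0r.
have h2 : psd (a%:M : 'M[K]_n).
  apply/psd_dot; split => [|x]; first by rewrite tr_scalar_mx.
  by rewrite mul_scalar_mx dotZr mulr_ge0// dot_ge0.
have [s1 _] := pi_pos h1; have [s2 _] := pi_pos h2.
have -> : pi X = pi (X + a%:M) - pi a%:M by rewrite -linearB addrK.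
by rewrite linearB /= s1 s2.
Qed.

(* Optimality of [pi Q] along the line [pi Q + e b], [b] in the ring: the
   coefficient of [e] must vanish. *)
Lemma condexp_module Q b : Q^T = Q -> b \in B ->
  pi (b *m Q + Q *m b^T) = pi (b *m pi Q + pi Q *m b^T).
Proof.
move=> sQ bB; have spQ := posmap_sym sQ; pose D := Q - pi Q.
have sD : D^T = D by rewrite linearB /= sQ spQ.
apply/eqP; rewrite -subr_eq0 -linearB opprD addrACA -mulmxBr -mulmxBl -/D.
have sbD : (b *m D + D *m b^T)^T = b *m D + D *m b^T.
  by rewrite linearD /= !trmx_mul trmxK sD addrC.
apply/eqP/psd_anti; first exact: posmap_sym.
have /pi_pos/psd_dot[_ pbb] : psd (b *m b^T).
  apply/psd_dot; split => [|x]; first by rewrite trmx_mul trmxK.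
  by rewrite -mulmxA dot_mulmxr dot_ge0.
move=> x; apply: (lin_coef_eq0 (pbb x)) => e.
have [_ /(_ (pi Q + e *: b))] := pi_argmin Q.
have : pi Q + e *: b \in B.
  apply/condexp_fix; rewrite linearD linearZ /= pi_idem.
  by move/condexp_fix : bB => ->.
move=> /[swap]/[apply]/psd_dot[_ /(_ x)]; rewrite -linearB /= -/D.
rewrite opprD addrA -/D.
(* The cost difference is quadratic in e, with linear coefficient the form of pi (b D + D b'), as
   [lin_coef_eq0] requires. *)
rewrite sq_line//.
have E c1 c2 X Z : dot x (pi (c1 *: X - c2 *: Z) *m x) =
    c1 * dot x (pi X *m x) - c2 * dot x (pi Z *m x).
  have -> : pi (c1 *: X - c2 *: Z) = c1 *: pi X - c2 *: pi Z.
    by rewrite linearB; congr (_ - _); exact: linearZ.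
  by rewrite mulmxBl -!scalemxAl !dot_lin.
by rewrite E.
Qed.

Variables (A S R : 'M[K]_n).
Hypotheses (sS : S^T = S) (sR : R^T = R).
Hypotheses (AB : A \in B) (ATB : A^T \in B) (SB : S \in B) (RB : R \in B).

Lemma Ricc_ring X : X \in B -> Ricc A S R X \in B.
Proof.
move=> XB; rewrite /Ricc; apply: ring_add => //; apply: ring_sub.
  by apply: ring_add; exact: ring_mul.
by apply: ring_mul => //; exact: ring_mul.
Qed.

Lemma Ricc_pi_fix X : X^T = X -> pi X = X -> Ricc_pi pi A S R X = Ricc A S R X.
Proof.
move=> sX pX; rewrite /Ricc_pi /Ricc pX linearB /= trmx_mul sS sX.
rewrite mulmxBl mulmxBr mulmxA; apply/matrixP => i j.
by move: (A *m X) (X *m A^T) (X *m S *m X) => ? ? ?; rewrite !mxE; ring.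
Qed.

(** By [condexp_module] with b = A - pi X S, the matrix X may be replaced by pi X under [pi]. As b
    and b' are in the ring, the result lies in the ring and is fixed by [pi]. *)
Lemma condexp_Ricc_pi X : X^T = X -> pi (Ricc_pi pi A S R X) = Ricc A S R (pi X).
Proof.
move=> sX; have spX := posmap_sym sX.
have pXB : pi X \in B by apply/condexp_fix.
rewrite -Ricc_pi_fix// /Ricc_pi pi_idem.
have bB : A - pi X *m S \in B by apply: ring_sub => //; exact: ring_mul.
have bTB : (A - pi X *m S)^T \in B.
  by rewrite linearB /= trmx_mul sS spX; apply: ring_sub => //; exact: ring_mul.
move: (A - pi X *m S) bB bTB => b bB bTB.
rewrite -[in LHS]addrA linearD condexp_module// -linearD addrA; apply/condexp_fix.
apply: ring_add; last by apply: ring_mul => //; exact: ring_mul.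
by apply: ring_add => //; apply: ring_add; exact: ring_mul.
Qed.

Lemma Ricc_pi_sym X : X^T = X -> (Ricc_pi pi A S R X)^T = Ricc_pi pi A S R X.
Proof.
move=> sX; have spX := posmap_sym sX.
rewrite /Ricc_pi; move: (A - _ *m S) => b.
by rewrite !linearD /= !trmx_mul trmxK sX sS sR spX mulmxA [X *m b^T + _]addrC.
Qed.

Lemma Ricc_pi_loclip : loclip (Ricc_pi pi A S R).
Proof.
have lp : loclip pi by apply: (loclip_linear pi); exact: loclip_id.
have lb : loclip (fun X => A - pi X *m S).
  apply: loclipD; first exact: loclip_cst.
  by apply/loclipN/loclipM => //; exact: loclip_cst.
apply: loclipD; last by apply: loclipM => //; apply: loclipM => //; exact: loclip_cst.
apply: loclipD; last exact: loclip_cst.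
apply: loclipD; first by apply: loclipM => //; exact: loclip_id.
apply: loclipM; first exact: loclip_id.
exact: (loclip_linear trmx).
Qed.

Variables (phi phipi : K -> 'M[K]_n -> 'M[K]_n).
Hypothesis phi_flow : psd_flow (Ricc A S R) phi.
Hypothesis phipi_flow : psd_flow (Ricc_pi pi A S R) phipi.

Lemma phipi_sym Q t : psd Q -> 0 <= t -> (phipi t Q)^T = phipi t Q.
Proof.
move=> pQ; have [sQ _] := pQ.
by apply: (ode_sym Ricc_pi_loclip Ricc_pi_sym (phipi_flow pQ) sQ).
Qed.

Lemma phi_sym Q t : psd Q -> 0 <= t -> (phi t Q)^T = phi t Q.
Proof.
move=> pQ; have [sQ _] := pQ; apply: (ode_sym _ _ (phi_flow pQ) sQ).
  exact: Ricc_loclip.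
by move=> X; exact: Ricc_sym.
Qed.

Lemma condexp_phi Q t : psd Q -> 0 <= t -> pi (phi t (pi Q)) = phi t (pi Q).
Proof.
move=> pQ t0; have ppQ := pi_pos pQ.
apply: (ode_invariant _ _ pi_idem (phi_flow ppQ) (pi_idem Q) t0).
  exact: Ricc_loclip.
by move=> X /condexp_fix/Ricc_ring/condexp_fix.
Qed.

(** The Riccati curve issued from pi Q stays in the ring, where both fields coincide; it thus solves
    the other equation. *)
Lemma phipi_phi Q t : psd Q -> 0 <= t -> phipi t (pi Q) = phi t (pi Q).
Proof.
move=> pQ; have ppQ := pi_pos pQ.
have [f0 _ _] := phi_flow ppQ; have [g0 _ _] := phipi_flow ppQ.
have sol1 := phi_flow ppQ; have sol2 := phipi_flow ppQ.
move: t; apply: (ode_unique (f := phipi^~ (pi Q)) (g := phi^~ (pi Q)) Ricc_pi_loclip).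
- by rewrite f0 g0.
- exact: ode_mcont sol2.
- by move=> t t0; exact: ode_mder sol2 t0.
- exact: ode_mcont sol1.
- move=> t t0; rewrite Ricc_pi_fix; first exact: ode_mder sol1 t0.
    by apply: phi_sym => //; exact: ltW.
  by apply: condexp_phi => //; exact: ltW.
Qed.

(** Applying [pi] to the equation of [phipi] yields the Riccati equation. The identity equates the
    gains of the two filters. *)
Lemma condexp_phipi Q t : psd Q -> 0 <= t -> pi (phipi t Q) = phi t (pi Q).
Proof.
move=> pQ; have ppQ := pi_pos pQ.
have [f0 _ _] := phi_flow ppQ; have [g0 _ _] := phipi_flow pQ.
have sol1 := phi_flow ppQ; have sol2 := phipi_flow pQ.
move: t; apply: (ode_unique (f := fun t => pi (phipi t Q)) (g := phi^~ (pi Q))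
  (@Ricc_loclip _ _ A S R)).
- by rewrite f0 g0.
- by apply: mcont_linear; exact: ode_mcont sol2.
- move=> t t0; rewrite -condexp_Ricc_pi; last by apply: phipi_sym => //; exact: ltW.
  by apply: mder_linear; exact: ode_mder sol2 t0.
- exact: ode_mcont sol1.
- by move=> t t0; exact: ode_mder sol1 t0.
Qed.

(** Once the gain pi X is frozen at Y, the field is affine in X, so no quadratic term remains. *)
Lemma Ricc_pi_sub X Y : Y^T = Y -> pi Y = Y -> pi X = Y ->
  Ricc_pi pi A S R X - Ricc A S R Y =
    (A - Y *m S) *m (X - Y) + (X - Y) *m (A - Y *m S)^T.
Proof.
move=> sY pY pX; rewrite -Ricc_pi_fix// /Ricc_pi pX pY !mulmxBr !(mulmxBl X).
apply/matrixP => i j.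
move: ((A - _) *m X) ((A - _) *m Y) (X *m (A - _)^T) (Y *m (A - _)^T) (Y *m S *m Y).
by move=> ? ? ? ? ?; rewrite !mxE; ring.
Qed.

End ConditionalExpectation.

(** * Exponential decay of the difference of the flows *)

Lemma Ricc_sub {K : realType} n (A S R X Y : 'M[K]_n) : S^T = S -> Y^T = Y ->
  Ricc A S R X - Ricc A S R Y = (A - Y *m S) *m (X - Y)
    + (X - Y) *m (A - Y *m S)^T - (X - Y) *m S *m (X - Y).
Proof.
move=> sS sY; have -> : (A - Y *m S)^T = A^T - S *m Y.
  by rewrite linearB /= trmx_mul sS sY.
rewrite /Ricc !(mulmxBl, mulmxBr) !mulmxA.
apply/matrixP => i j.
move: (A *m X) (A *m Y) (X *m A^T) (Y *m A^T) (X *m S *m X) (X *m S *m Y)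
  (Y *m S *m X) (Y *m S *m Y).
by move=> ? ? ? ? ? ? ? ?; rewrite !mxE; ring.
Qed.

Lemma small_rates {K : realFieldType} (r a s M0 lam : K) :
  0 < r -> 0 <= a -> 0 <= s -> 0 < M0 -> 0 < lam ->
  exists eta rho, [/\ 0 < eta, 0 < rho, rho <= lam &
    0 < r - rho * (M0 + eta) - 2 * eta * a - eta ^+ 2 * s].
Proof.
move=> r0 a0 s0 M00 lam0.
have d1 : 0 < 4 * (2 * a + s + 1) by lra.
have d2 : 0 < 4 * (M0 + 1) by lra.
(* With eta <= 1, the terms in eta and the term in rho each cost at most r / 4. *)
pose eta := Num.min 1 (r / (4 * (2 * a + s + 1))).
pose rho := Num.min lam (r / (4 * (M0 + 1))).
have eta0 : 0 < eta by rewrite lt_min ltr01 divr_gt0.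
have rho0 : 0 < rho by rewrite lt_min lam0 divr_gt0.
have eta1 : eta <= 1 by rewrite ge_min lexx.
have rho1 : rho <= lam by rewrite ge_min lexx.
have h1 : eta * (4 * (2 * a + s + 1)) <= r.
  by rewrite -ler_pdivlMr// ge_min lexx orbT.
have h2 : rho * (4 * (M0 + 1)) <= r by rewrite -ler_pdivlMr// ge_min lexx orbT.
exists eta, rho; split => //.
have k1 : rho * (M0 + eta) <= rho * (M0 + 1) by rewrite ler_pM2l// lerD2l.
have k2 : eta ^+ 2 * s <= eta * s.
  by rewrite expr2 -mulrA ler_piMl// mulr_ge0// ltW.
lra.
Qed.

Section Decay.
Context {K : realType} {n : nat}.
Variables (B : {pred 'M[K]_n}) (pi : {linear 'M[K]_n -> 'M[K]_n}).
Hypothesis B_ring : matrix_ring B.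
Hypothesis pi_pos : positive_map pi.
Hypothesis pi_idem : forall Q, pi (pi Q) = pi Q.
Hypothesis pi_range : forall M, M \in B <-> exists Q, pi Q = M.
Hypothesis pi_argmin : forall Q : 'M[K]_n,
  loewner_argmin B (fun N => pi ((Q - N) *m (Q - N)^T)) (pi Q).
Variables (A S R : 'M[K]_n).
Hypotheses (AB : A \in B) (ATB : A^T \in B) (SB : S \in B) (RB : R \in B).
Hypotheses (pS : psd S) (pR : posdef R).
Variables (phi phipi : K -> 'M[K]_n -> 'M[K]_n).
Hypothesis phi_flow : psd_flow (Ricc A S R) phi.
Hypothesis phipi_flow : psd_flow (Ricc_pi pi A S R) phipi.

(** The difference is split at the Riccati flow issued from pi Q, and both parts are bounded from
    above and from below: four uses of [riccati_decay], with N = 0 for the first part and N = D S D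
    for the second. *)
Lemma condexp_decay lam W : 0 < lam -> posdef W ->
  A^T *m W + W *m A = S - lam *: W ->
  exists2 rho : K, 0 < rho & exists c : K -> K, forall Q t, psd Q -> 0 <= t ->
    spectral_norm (phipi t Q - phi t Q) <=
      c (spectral_norm Q) * expR (- (rho * t)) * spectral_norm (Q - pi Q).
Proof.
move=> lam0 pW WE; have [sS _] := (psd_dot S).1 pS.
have [sR _] := (posdef_dot R).1 pR.
have [M0 [y [M00 y0 hup]]] := riccati_upper sS pR pS lam0 pW WE.
have [r r0 hr] := posdef_lb pR.
have [a a0 ha] := dot_bound A; have [s s0 hs] := dot_bound S.
have [eta [rho [eta0 rho0 rhol hc]]] := small_rates r0 a0 s0 M00 lam0.
have [k k0 hk] := linear_dot_bound pi.
have {}ha x : dot x (A *m x) <= a * dot x x by rewrite (le_trans (ler_norm _)).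
have {}hs x : dot x (S *m x) <= s * dot x x by rewrite (le_trans (ler_norm _)).
(* The constant of [riccati_decay] as a function of the norm z of [Q]; the factor 2 below counts the
   two parts. *)
pose g z := (M0 + y * ((k + 1) * z)) / eta * (1 + eta / M0).
exists rho => //; exists (fun z => 2 * g z) => Q t pQ t0.
have ppQ := pi_pos pQ.
set nQ := spectral_norm Q; set dQ := spectral_norm (Q - pi Q).
have nQ0 : 0 <= nQ by exact: spectral_norm_ge0.
have dQ0 : 0 <= dQ by exact: spectral_norm_ge0.
(* A common bound for the forms of [Q] and [pi Q], hence for both base flows. *)
pose b := (k + 1) * nQ; have b0 : 0 <= b by rewrite mulr_ge0// addr_ge0.
have bQ x : dot x (Q *m x) <= b * dot x x.
  rewrite (le_trans (ler_norm _))// (le_trans (spectral_norm_dot _ _))//.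
  by rewrite ler_wpM2r ?dot_ge0// /b mulrDl mul1r lerDr mulr_ge0.
have bpQ x : dot x (pi Q *m x) <= b * dot x x.
  rewrite (le_trans (ler_norm _))// (le_trans (hk _ _))//.
  by rewrite ler_wpM2r ?dot_ge0// /b mulrDl mul1r lerDl.
have up X : psd X -> (forall x, dot x (X *m x) <= b * dot x x) ->
    forall u x, 0 <= u ->
    dot x (phi u X *m x) <= (M0 + y * b * expR (- rho * u)) * dot x x.
  by move=> pX bX u x u0; exact: (hup rho b X (phi^~ X) rho0 rhol (phi_flow pX) pX b0 bX u x u0).
have yb0 : 0 <= y * b by rewrite mulr_ge0.
have main X D N : psd X -> (forall x, dot x (X *m x) <= b * dot x x) ->
    mcont D -> (forall u, 0 <= u -> (D u)^T = D u) ->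
    (forall u : K, 0 < u -> mder D u ((A - phi u X *m S) *m D u
      + D u *m (A - phi u X *m S)^T - N u)) ->
    (forall u x, 0 < u -> 0 <= dot x (N u *m x)) ->
    (forall x, dot x (D 0 *m x) <= dQ * dot x x) ->
    forall x, dot x (D t *m x) <= g nQ * dQ * expR (- rho * t) * dot x x.
  move=> pX bX cD sD hD hN hD0 x.
  exact: (riccati_decay pS pR (phi_flow pX) pX hr ha hs eta0 rho0 M00 yb0 dQ0 hc
    (up X pX bX) cD sD hD hN hD0 x t0).
have [p0 _ _] := phi_flow ppQ; have [q0 _ _] := phi_flow pQ.
have [P0 _ _] := phipi_flow pQ.
have cp := ode_mcont (phi_flow ppQ); have cq := ode_mcont (phi_flow pQ).
have cP := ode_mcont (phipi_flow pQ).
have dp := fun u => ode_mder (t := u) (phi_flow ppQ).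
have dq := fun u => ode_mder (t := u) (phi_flow pQ).
have dP := fun u => ode_mder (t := u) (phipi_flow pQ).
have sp := fun u => @phi_sym _ _ A S R sS sR phi phi_flow (pi Q) u ppQ.
have sq := fun u => @phi_sym _ _ A S R sS sR phi phi_flow Q u pQ.
have sP := fun u => @phipi_sym _ _ pi pi_pos A S R sS sR phipi phipi_flow Q u pQ.
have dQl x : dot x ((Q - pi Q) *m x) <= dQ * dot x x.
  by rewrite (le_trans (ler_norm _))// spectral_norm_dot.
have dQr x : dot x ((pi Q - Q) *m x) <= dQ * dot x x.
  rewrite -opprB mulNmx dotNr (le_trans (ler_norm _))// normrN.
  exact: spectral_norm_dot.
have dPp u : 0 < u -> Ricc_pi pi A S R (phipi u Q) - Ricc A S R (phi u (pi Q)) =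
    (A - phi u (pi Q) *m S) *m (phipi u Q - phi u (pi Q)) +
    (phipi u Q - phi u (pi Q)) *m (A - phi u (pi Q) *m S)^T.
  move=> /ltW u0; apply: Ricc_pi_sub => //; first exact: sp.
    exact: (condexp_phi B_ring pi_pos pi_idem pi_range AB ATB SB RB phi_flow pQ u0).
  exact: (condexp_phipi B_ring pi_pos pi_idem pi_range pi_argmin sS sR AB ATB SB RB
    phi_flow phipi_flow pQ u0).
have h1 := main (pi Q) (fun u => phipi u Q - phi u (pi Q)) (fun=> 0) ppQ bpQ.
have h2 := main (pi Q) (fun u => phi u (pi Q) - phipi u Q) (fun=> 0) ppQ bpQ.
have h3 := main (pi Q) (fun u => phi u Q - phi u (pi Q))
  (fun u => (phi u Q - phi u (pi Q)) *m S *m (phi u Q - phi u (pi Q))) ppQ bpQ.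
(* The base flow is now the one issued from [Q]: exchanging the roles keeps the favourable sign of
   the quadratic term, which negating D would reverse. *)
have h4 := main Q (fun u => phi u (pi Q) - phi u Q)
  (fun u => (phi u (pi Q) - phi u Q) *m S *m (phi u (pi Q) - phi u Q)) pQ bQ.
have symB (X Y : 'M[K]_n) : X^T = X -> Y^T = Y -> (X - Y)^T = X - Y.
  by move=> sX sY; rewrite linearB /= sX sY.
have quadS (X : 'M[K]_n) x : X^T = X -> 0 <= dot x (X *m S *m X *m x).
  by move=> sX; rewrite -!mulmxA dot_mulmxr sX; case/psd_dot: pS.
have {}h1 := h1 (mcontB cP cp) (fun u u0 => symB _ _ (sP u u0) (sp u u0)).
have {}h2 := h2 (mcontB cp cP) (fun u u0 => symB _ _ (sp u u0) (sP u u0)).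
have {}h3 := h3 (mcontB cq cp) (fun u u0 => symB _ _ (sq u u0) (sp u u0)).
have {}h4 := h4 (mcontB cp cq) (fun u u0 => symB _ _ (sp u u0) (sq u u0)).
have {}h1 x : dot x ((phipi t Q - phi t (pi Q)) *m x) <=
    g nQ * dQ * expR (- rho * t) * dot x x.
  apply: h1 => [u u0|u z _|z]; last by rewrite P0 p0.
    by rewrite subr0 -dPp//; apply: mderB; [exact: dP|exact: dp].
  by rewrite mul0mx dot0r.
have {}h2 x : dot x ((phi t (pi Q) - phipi t Q) *m x) <=
    g nQ * dQ * expR (- rho * t) * dot x x.
  apply: h2 => [u u0|u z _|z]; last by rewrite P0 p0.
    have := mderB (dp u u0) (dP u u0); rewrite -[Ricc _ _ _ _ - _]opprB dPp//.
    by move: (A - _ *m S) => b'; rewrite opprD -mulmxN -mulNmx !opprB subr0.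
  by rewrite mul0mx dot0r.
have {}h3 x : dot x ((phi t Q - phi t (pi Q)) *m x) <=
    g nQ * dQ * expR (- rho * t) * dot x x.
  apply: h3 => [u u0|u z u0|z]; last by rewrite q0 p0.
    rewrite -(Ricc_sub A R)//; last exact: sp (ltW u0).
    by apply: mderB; [exact: dq|exact: dp].
  by apply/quadS/symB; [exact: sq (ltW u0)|exact: sp (ltW u0)].
have {}h4 x : dot x ((phi t (pi Q) - phi t Q) *m x) <=
    g nQ * dQ * expR (- rho * t) * dot x x.
  apply: h4 => [u u0|u z u0|z]; last by rewrite q0 p0.
    rewrite -(Ricc_sub A R)//; last exact: sq (ltW u0).
    by apply: mderB; [exact: dp|exact: dq].
  by apply/quadS/symB; [exact: sp (ltW u0)|exact: sq (ltW u0)].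
have g0 : 0 <= g nQ.
  by rewrite /g mulr_ge0 ?divr_ge0 ?addr_ge0 ?divr_ge0 ?(ltW eta0) ?(ltW M00)//.
apply: spectral_norm_sym_le.
- by apply: symB; [exact: sP|exact: sq].
- by apply: mulr_ge0 => //; apply: mulr_ge0; [exact: mulr_ge0|exact: expR_ge0].
move=> x; rewrite -mulNr.
have -> : 2 * g nQ * expR (- rho * t) * dQ * dot x x =
  g nQ * dQ * expR (- rho * t) * dot x x + g nQ * dQ * expR (- rho * t) * dot x x.
  by ring.
have -> : phipi t Q - phi t Q =
    (phipi t Q - phi t (pi Q)) + (phi t (pi Q) - phi t Q).
  by rewrite addrA subrK.
have opp X Y : dot x ((X - Y) *m x) = - dot x ((Y - X) *m x).
  by rewrite -opprB mulNmx dotNr.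
rewrite mulmxDl dotDr; have := h2 x; have := h3 x; rewrite (opp (phi t Q)) (opp _ (phipi t Q)).
move: (h1 x) (h4 x).
move: (dot x ((phi t (pi Q) - phi t Q) *m x)).
move: (dot x ((phipi t Q - phi t (pi Q)) *m x)).
set c := g nQ * _ * _ * dot x x; move=> u v l1 l2 l3 l4.
by rewrite ler_norml; apply/andP; split; lra.
Qed.

End Decay.

(** * Derivation of the three claims for the filtering model *)

Theorem theorem3
  (K : realType) (r r' : nat)
  (A : 'M[K]_r) (C : 'M[K]_(r', r)) (R : 'M[K]_r) (Sigma : 'M[K]_r')
  (Rh : 'M[K]_r) (Sigmah : 'M[K]_r') (S : 'M[K]_r)
  (R_posdef : posdef R) (Sigma_posdef : posdef Sigma)
  (Rh_sqrt : psd_sqrt Rh R) (Sigmah_sqrt : psd_sqrt Sigmah Sigma)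
  (S_def : S = C^T *m invmx Sigma *m C)
  (ctrl : controllable A Rh) (obs : observable A C)
  (d : measure_display) (Omega : measurableType d) (P : probability Omega K)
  (W : K -> Omega -> 'cV[K]_r) (V : K -> Omega -> 'cV[K]_r')
  (X : K -> Omega -> 'cV[K]_r) (Y : K -> Omega -> 'cV[K]_r')
  (WV_brownian : brownian_motion P (fun t w => col_mx (W t w) (V t w)))
  (X0_gaussian : gaussian_vector P (X 0))
  (X0_indep : independent_vector_process P (X 0)
                (fun t w => col_mx (W t w) (V t w)))
  (X_signal : signal_process P A Rh W X)
  (Y_obs : observation_process P C Sigmah V X Y)
  (B : {pred 'M[K]_r}) (B_ring : matrix_ring B)
  (pi : {linear 'M[K]_r -> 'M[K]_r})
  (pi_pos : positive_map pi)
  (pi_idem : forall Q, pi (pi Q) = pi Q)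
  (pi_range : forall M, M \in B <-> exists Q, pi Q = M)
  (pi_argmin : forall Q : 'M[K]_r,
     loewner_argmin B (fun N => pi ((Q - N) *m (Q - N)^T)) (pi Q))
  (AB : A \in B) (ATB : A^T \in B) (SB : S \in B) (RB : R \in B)
  (phi phipi : K -> 'M[K]_r -> 'M[K]_r)
  (phi_flow : psd_flow (Ricc A S R) phi)
  (phipi_flow : psd_flow (Ricc_pi pi A S R) phipi)
  (psi psipi : K -> K -> 'cV[K]_r -> 'M[K]_r -> Omega -> 'cV[K]_r)
  (psi_filter : forall s x Q, 0 <= s -> psd Q ->
     filter_solution P A C Sigma Y (fun t => phi (t - s) Q) s x
       (fun t => psi s t x Q))
  (psipi_filter : forall s x Q, 0 <= s -> psd Q ->
     filter_solution P A C Sigma Y (fun t => pi (phipi (t - s) Q)) s x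
       (fun t => psipi s t x Q)) :
  [/\ (forall Q t, psd Q -> 0 <= t -> phipi t (pi Q) = phi t (pi Q)),
      (forall x Q s, psd Q -> 0 <= s ->
         {ae P, forall w, forall t, s <= t ->
            psipi s t x Q w = psi s t x (pi Q) w}) &
      exists2 rho : K, 0 < rho &
      exists c : K -> K, forall Q t, psd Q -> 0 <= t ->
        spectral_norm (phipi t Q - phi t Q) <=
          c (spectral_norm Q) * expR (- (rho * t)) * spectral_norm (Q - pi Q)].
Proof.
have pS : psd S.
  rewrite S_def; have [sI _] := (posdef_dot _).1 (posdef_inv Sigma_posdef).
  apply/psd_dot; split => [|x]; first by rewrite !trmx_mul trmxK sI mulmxA.
  rewrite -!mulmxA dot_mulmxr trmxK.
  by have /posdef_psd/psd_dot[_] := posdef_inv Sigma_posdef; apply.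
(* Definiteness of the inverse of Sigma carries the observability of (A, C) over to [S]. *)
have SC (x : 'cV_r) : S *m x = 0 -> C *m x = 0.
  move=> Sx; have [_ pI] := (posdef_dot _).1 (posdef_inv Sigma_posdef).
  apply/eqP; apply: contraT => /pI.
  have : dot x (S *m x) = 0 by rewrite Sx dot0r.
  by rewrite S_def -!mulmxA dot_mulmxr trmxK => ->; rewrite ltxx.
have [lam [Wl [lam0 pW WE]]] := observable_lyapunov obs pS SC.
have [sS _] := (psd_dot S).1 pS; have [sR _] := (posdef_dot R).1 R_posdef.
split.
- move=> Q t pQ t0.
  exact: (phipi_phi B_ring pi_pos pi_idem pi_range sS sR AB ATB SB RB phi_flow
    phipi_flow pQ t0).
(* By [condexp_phipi], both filters have the gain built from the Riccati flow issued from [pi Q]. *)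
- move=> x Q s pQ s0; have ppQ := pi_pos _ pQ.
  apply: (filter_unique _ _ _ (psipi_filter s x Q s0 pQ)
    (psi_filter s x (pi Q) s0 ppQ)) => [u su|u su|].
  + by case: Y_obs => -[mY _] _; apply: mY; exact: le_trans su.
  + rewrite (condexp_phipi B_ring pi_pos pi_idem pi_range pi_argmin sS sR AB ATB SB RB
      phi_flow phipi_flow pQ)//.
    by rewrite subr_ge0.
  + rewrite (_ : (fun t => _) = phi^~ (pi Q)); first exact: ode_mcont (phi_flow _ ppQ).
    by apply/funext => t; rewrite addrK.
- exact: (condexp_decay B_ring pi_pos pi_idem pi_range pi_argmin AB ATB SB RB pS
    R_posdef phi_flow phipi_flow lam0 pW WE).
Qed.
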